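(* Let $(M,g)$ be a smooth $n$-dimensional Riemannian manifold, $n\ge 3$, with Ricci tensor $\mathsf{Ri}\ne 0$. If $\mathsf{Ri}$ is Ricci recurrent and $n=3$, then it is automatically quasi Einstein. If $n>3$, then $\mathsf{Ri}$ cannot be both Ricci recurrent and quasi Einstein.
   Context: $g$ is positive definite, a semicolon denotes covariant differentiation with respect to the Levi-Civita connection, and $|\cdot|$ is the pointwise norm induced by $g$. The Ricci tensor is Ricci recurrent if there is a nonzero one-form $\beta$ such that $\mathsf{Ri}_{ij;\ell}=\beta_\ell\,\mathsf{Ri}_{ij}$. It is quasi Einstein if there are functions $a$ and $b$ and a one-form $\omega$ such that $\mathsf{Ri}=a\,g+b\,\frac{\omega\otimes\omega}{|\omega|^2}$ (if $b=0$ the Ricci tensor is Einstein).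
   Formalization: The one-form ω of ''quasi Einstein'' is only asked to exist near each point (a, b are global), since a global smooth ω can fail for n=3, e.g. (ellipsoid×R)/±1; ''nonzero one-form β'' means not identically zero on each connected component. *)

(* Defs.v *)
From HB Require Import structures.
From mathcomp Require Import all_boot all_order all_algebra.
From mathcomp Require Import all_classical all_reals all_analysis.
Set Implicit Arguments.
Unset Strict Implicit.
Unset Printing Implicit Defensive.
Import Order.TTheory GRing.Theory Num.Theory.
Import numFieldNormedType.Exports.
Local Open Scope classical_set_scope.
Local Open Scope ring_scope.

Definition partial (R : realType) (n : nat) (V : normedModType R) (i : 'I_n)
    (f : 'rV[R]_n -> V) : 'rV[R]_n -> V :=
  fun x => 'D_(delta_mx 0 i) f x.

Fixpoint diff_order (R : realType) (n : nat) (V : normedModType R) (k : nat)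
    (U : set 'rV[R]_n) (f : 'rV[R]_n -> V) : Prop :=
  if k is k'.+1 then
    (forall x, U x -> differentiable f x) /\
    (forall i, diff_order k' U (partial i f))
  else True.

(* C^oo on the open set U: partial derivatives of all orders exist and are
   (Frechet) differentiable, hence continuous, at every point of U. *)
Definition smooth (R : realType) (n : nat) (V : normedModType R)
    (U : set 'rV[R]_n) (f : 'rV[R]_n -> V) : Prop :=
  forall k, diff_order k U f.

(* Smooth n-manifolds (without boundary, not assumed connected), given by a
   smooth atlas. [coord c] and [param c] are meaningful only on [dom c] and on
   the open set [coord c @` dom c] of R^n, respectively. *)
Record manifold (R : realType) (n : nat) := Manifold {
  carrier :> topologicalType;
  chart : Type;
  dom : chart -> set carrier;
  coord : chart -> carrier -> 'rV[R]_n;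
  param : chart -> 'rV[R]_n -> carrier;
  carrier_hausdorff : hausdorff_space carrier;
  carrier_second_countable : @second_countable carrier;
  dom_open : forall c, open (dom c);
  dom_cover : forall p, exists c, dom c p;
  coordK : forall c p, dom c p -> param c (coord c p) = p;
  coord_open : forall c, open (coord c @` dom c);
  coord_cont : forall c p, dom c p -> {for p, continuous (coord c)};
  param_cont : forall c x, (coord c @` dom c) x ->
    {for x, continuous (param c)};
  transition_smooth : forall c d,
    smooth (coord c @` (dom c `&` dom d)) (coord d \o param c)
}.

Section Geometry.
Variables (R : realType) (n : nat) (M : manifold R n).
Implicit Types (c d : chart M) (x : 'rV[R]_n).

Definition transition c d : 'rV[R]_n -> 'rV[R]_n := coord d \o param c.

(* [transition_jac c d x i k] is the derivative of the k-th coordinate of [d]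
   along the i-th coordinate of [c]. *)
Definition transition_jac c d x : 'M[R]_n :=
  \matrix_(i, k) partial i (transition c d) x 0 k.

Definition smooth_fun (a : M -> R) : Prop :=
  forall c, smooth (coord c @` dom c) (a \o param c : 'rV[R]_n -> R^o).

(* Tensor fields are given, as in index notation, by their components in every
   chart, related by the tensor transformation law on overlaps. *)
Record oneForm (U : set M) := OneForm {
  form :> chart M -> 'rV[R]_n -> 'rV[R]_n;
  form_smooth : forall c, smooth (coord c @` (dom c `&` U)) (form c);
  form_law : forall c d p, U p -> dom c p -> dom d p ->
    form c (coord c p) =
    form d (coord d p) *m (transition_jac c d (coord c p))^T
}.

Record metric := Metric {
  gij :> chart M -> 'rV[R]_n -> 'M[R]_n;
  gij_smooth : forall c, smooth (coord c @` dom c) (gij c);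
  gij_law : forall c d p, dom c p -> dom d p ->
    gij c (coord c p) =
    transition_jac c d (coord c p) *m gij d (coord d p)
      *m (transition_jac c d (coord c p))^T;
  gij_sym : forall c p, dom c p -> (gij c (coord c p))^T = gij c (coord c p);
  gij_pos : forall c p (v : 'rV[R]_n), dom c p -> v != 0 ->
    0 < (v *m gij c (coord c p) *m v^T) 0 0
}.

Variable g : metric.

Definition inv_metric c x : 'M[R]_n := invmx (g c x).

Definition dmetric c x (l i j : 'I_n) : R := partial l (g c) x i j.

(* Christoffel symbols Gamma^k_ij of the Levi-Civita connection. *)
Definition christoffel c x (k i j : 'I_n) : R :=
  2^-1 * \sum_l inv_metric c x k l *
    (dmetric c x i j l + dmetric c x j i l - dmetric c x l i j).

Definition dchristoffel c x (m k i j : 'I_n) : R :=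
  partial m (fun y => christoffel c y k i j : R^o) x.

(* The components R^k_lij, where R(d_i, d_j) d_l = R^k_lij d_k. *)
Definition riemann c x (k l i j : 'I_n) : R :=
  dchristoffel c x i k j l - dchristoffel c x j k i l
  + \sum_m (christoffel c x k i m * christoffel c x m j l
            - christoffel c x k j m * christoffel c x m i l).

Definition ricci c x : 'M[R]_n :=
  \matrix_(i, j) \sum_k riemann c x k i k j.

(* T_ij;l *)
Definition cov_deriv (T : chart M -> 'rV[R]_n -> 'M[R]_n) c x
    (i j l : 'I_n) : R :=
  partial l (fun y => T c y i j : R^o) x
  - \sum_m (christoffel c x m l i * T c x m j
            + christoffel c x m l j * T c x i m).

Definition ricci_nonzero : Prop :=
  exists c p, dom c p /\ ricci c (coord c p) != 0.

(* On a connected M this says that the form does not vanish identically. On a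
   disconnected M it excludes forms vanishing on a whole component, since the
   components are then unrelated manifolds: a component where Ri = 0 satisfies
   the recurrence for every one-form. *)
Definition form_nonzero (w : oneForm setT) : Prop :=
  forall p, exists q c, [/\ connected_component [set: M] p q,
    dom c q & w c (coord c q) != 0].

Definition ricci_recurrent : Prop :=
  exists2 beta : oneForm setT, form_nonzero beta &
    forall c p, dom c p -> forall i j l,
      cov_deriv ricci c (coord c p) i j l =
      beta c (coord c p) 0 l * ricci c (coord c p) i j.

Definition norm2 c x (w : 'rV[R]_n) : R :=
  (w *m inv_metric c x *m w^T) 0 0.

(* The functions a and b are global; the one-form is only asked to exist near
   every point. Only the tensor w (x) w / |w|^2 is determined by Ri, and it
   determines w / |w| up to sign: on the quotient of S x R (S an orientable
   surface) by an involution reversing R, the line field of w may admit no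
   nowhere vanishing global section. *)
Definition quasi_einstein : Prop :=
  exists a b : M -> R, [/\ smooth_fun a, smooth_fun b &
    forall p, exists (U : set M) (w : oneForm U), [/\ open U, U p &
      forall c q, U q -> dom c q ->
        w c (coord c q) != 0 /\
        ricci c (coord c q) = a q *: g c (coord c q)
          + b q *: ((norm2 c (coord c q) (w c (coord c q)))^-1
                      *: ((w c (coord c q))^T *m w c (coord c q)))]].

End Geometry.

(* Main.v *)
From HB Require Import structures.
From Pilot Require Import Defs.
From mathcomp Require Import all_boot all_order all_algebra.
From mathcomp Require Import all_classical all_reals all_analysis.
From mathcomp Require Import ring lra.
Set Implicit Arguments.
Unset Strict Implicit.
Unset Printing Implicit Defensive.
Import Order.TTheory GRing.Theory Num.Theory.
Import numFieldNormedType.Exports.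
(* Again, because [coord] is shadowed by the vector space library. *)
Import Pilot.Defs.
Local Open Scope classical_set_scope.
Local Open Scope ring_scope.

(** The recurrence [Ri_ij;l = be_l Ri_ij] implies that the scalar curvature [s],
    [|Ri|^2] and the other polynomial invariants of [Ri] satisfy [df = k be f],
    so that each of them vanishes identically or nowhere on a component. Where
    [Ri <> 0], [be] is half the differential of [log |Ri|^2], hence closed, and
    the Ricci identity shows that the curvature operators commute with [Ri]. The
    contracted Bianchi identity makes [be] an eigenvector of [Ri] with
    eigenvalue [s/2].

    If [Ri = a g + b w (x) w / |w|^2], then [b <> 0] at a point where [be <> 0],
    because otherwise [Ri = 0]; as the curvature operators are skew and commute
    with [Ri], they kill [w], so [Ri w = 0] and the eigenvalues of [Ri] are
    [a, ..., a, 0]. Then [(n - 1) a / 2] is one of them, which forces [n = 3].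

    If [n = 3], the curvature is determined by [Ri]; contracting it twice with
    [be] gives [be_i be_l R^i_j^l_k = |be|^2 Ri_jk - (s/2) be_j be_k] up to sign,
    and composing with [Ri] yields [Ri^2 = (s/2) Ri]. This identity propagates
    to the whole component, so [s g - 2 Ri] has rank one wherever [s <> 0]. *)

(** * Smooth functions on open subsets of R^n *)

(** [be] may have zeros, where its eigenvector equation is empty, so the algebra is done at one
    point of a component where neither [be] nor Ri vanishes. What it yields is carried to the other
    points by scalars: the connection terms drop out of the derivative of a trace, and since the
    metric is positive definite, a self-adjoint operator vanishes as soon as its square has trace
    zero. Thus Ri is carried by |Ri|^2, and the tensor Ri^2 - (s/2) Ri by its squared norm. In
    dimension three, components where Ri = 0 satisfy the conclusion with a = b = 0.

    The eigenvalue s/2 comes from 2 div Ri = ds, in which the recurrence makes div Ri the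
    contraction of Ri with [be], and ds = s be.

    An operator is a matrix whose rows carry the lower index and whose columns carry the upper one.
    It then acts on row vectors from the right, and most of the tensor calculus in a chart becomes
    identities between noncommutative polynomials in the connection matrices, the metric and their
    derivatives. *)

Section Smoothness.
Variables (R : realType) (n : nat).
Local Notation vec := 'rV[R]_n.
Implicit Types (U : set vec) (x : vec) (f g : vec -> R^o).

Lemma differentiable_near_eq (V W : normedModType R) (f g : V -> W) (x : V) :
  (\near x, f x = g x) -> differentiable f x -> differentiable g x.
Proof.
move=> fg df; have [cdf /eqaddoP dfE] := (diff_locallyP _ _).1 df.
have fgx := nbhs_singleton fg.
have gE : g \o shift x = cst (g x) + 'd f x +o_ 0 id.
  apply/eqaddoP => e e0; rewrite (near_shift 0 x) /= subr0 in fg.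
  apply: (filterS2 _ _ fg (dfE e e0)) => h /= fgh.
  by rewrite ![((_ - _) h)]/GRing.add /= /cst /= fgx fgh.
have dg : 'd g x = 'd f x :> (V -> W) by exact: diff_unique.
by apply/diff_locallyP; rewrite dg.
Qed.

Lemma partialE (V : normedModType R) (i : 'I_n) (f : vec -> V) x :
  differentiable f x -> partial i f x = 'd f x (delta_mx 0 i).
Proof. exact: deriveE. Qed.

Lemma partial_near_eq (V : normedModType R) (i : 'I_n) (f g : vec -> V) x :
  (\near x, f x = g x) -> partial i f x = partial i g x.
Proof. exact: near_eq_derive. Qed.

Lemma near_open U (P : vec -> Prop) : open U -> (forall x, U x -> P x) ->
  forall x, U x -> \near x, P x.
Proof. by move=> oU UP x Ux; near=> y; apply: UP; near: y; exact: open_nbhs_nbhs.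
Unshelve. all: by end_near. Qed.

(** Openness of [U] lets the agreement pass to the partial derivatives. The sum, product, inverse
    and chain rules go through this lemma, as their formulas for partial derivatives hold only on
    [U]. *)
Lemma diff_order_ext (V : normedModType R) k U (f g : vec -> V) : open U ->
  (forall x, U x -> f x = g x) -> diff_order k U f -> diff_order k U g.
Proof.
move=> oU; elim: k f g => // k IH f g fg [df pf]; split.
  by move=> x Ux; apply: differentiable_near_eq (df x Ux); exact: (near_open oU fg Ux).
move=> i; apply: IH (pf i) => x Ux.
by apply: partial_near_eq; exact: (near_open oU fg Ux).
Qed.

Lemma diff_orderW (V : normedModType R) k U (f : vec -> V) :
  diff_order k.+1 U f -> diff_order k U f.
Proof.
elim: k f => // k IH f [df pf]; split=> // i.
by apply: IH; exact: pf.
Qed.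

Lemma diff_order_sub (V : normedModType R) k U U' (f : vec -> V) :
  U' `<=` U -> diff_order k U f -> diff_order k U' f.
Proof.
move=> UU'; elim: k f => // k IH f [df pf].
by split=> [x /UU' /df//|i]; exact/IH/pf.
Qed.

Lemma partialD (V : normedModType R) i (f g : vec -> V) x :
  differentiable f x -> differentiable g x ->
  partial i (f \+ g) x = partial i f x + partial i g x.
Proof. by move=> df dg; apply: deriveD; exact: diff_derivable. Qed.

Lemma partialM i f g x : differentiable f x -> differentiable g x ->
  partial i (fun y => f y * g y : R^o) x = f x * partial i g x + g x * partial i f x.
Proof. by move=> df dg; apply: deriveM; exact: diff_derivable. Qed.

Lemma partialV i f x : differentiable f x -> f x != 0 ->
  partial i (fun y => (f y)^-1 : R^o) x = - (f x) ^- 2 * partial i f x.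
Proof. by move=> df f0; apply: deriveV => //; exact: diff_derivable. Qed.

Lemma partialZ (V : normedModType R) i k (f : vec -> V) x : differentiable f x ->
  partial i (fun y => k *: f y) x = k *: partial i f x.
Proof. by move=> df; apply: deriveZ; exact: diff_derivable. Qed.

Lemma partial_cst (V : normedModType R) i (a : V) x :
  partial i (fun=> a) x = 0.
Proof. exact: derive_cst. Qed.

Lemma diff_order_cst (V : normedModType R) k U (a : V) : open U -> diff_order k U (fun=> a).
Proof.
move=> oU; elim: k a => // k IH a; split=> [x _|i]; first exact: differentiable_cst.
by apply: (diff_order_ext oU _ (IH 0)) => x _; rewrite partial_cst.
Qed.

Lemma diff_orderD (V : normedModType R) k U (f g : vec -> V) : open U ->
  diff_order k U f -> diff_order k U g -> diff_order k U (f \+ g).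
Proof.
move=> oU; elim: k f g => // k IH f g [df pf] [dg pg]; split.
  by move=> x Ux; apply: differentiableD; [exact: df|exact: dg].
move=> i; apply: (diff_order_ext oU _ (IH _ _ (pf i) (pg i))) => x Ux /=.
by rewrite partialD//; [exact: df|exact: dg].
Qed.

Lemma diff_orderM k U f g : open U ->
  diff_order k U f -> diff_order k U g ->
  diff_order k U (fun x => f x * g x : R^o).
Proof.
move=> oU; elim: k f g => // k IH f g fk gk; split.
  by move=> x Ux; apply: differentiableM; [exact: fk.1|exact: gk.1].
move=> i.
have h := diff_orderD oU (IH _ _ (diff_orderW fk) (gk.2 i))
  (IH _ _ (diff_orderW gk) (fk.2 i)).
apply: (diff_order_ext oU _ h) => x Ux /=.
by rewrite partialM//; [exact: fk.1|exact: gk.1].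
Qed.

Lemma diff_orderV k U f : open U -> (forall x, U x -> f x != 0) ->
  diff_order k U f -> diff_order k U (fun x => (f x)^-1 : R^o).
Proof.
move=> oU f0; elim: k => // k IH fk; split.
  by move=> x Ux; apply: differentiableV; [exact: fk.1|exact: f0].
move=> i; have fV := IH (diff_orderW fk).
have h := diff_orderM oU (diff_order_cst k (-1 : R^o) oU)
  (diff_orderM oU (diff_orderM oU fV fV) (fk.2 i)).
apply: (diff_order_ext oU _ h) => x Ux /=.
rewrite partialV//; [|exact: fk.1|exact: f0].
by rewrite expr2 invfM mulN1r mulNr.
Qed.

Lemma smooth_ext (V : normedModType R) U (f g : vec -> V) : open U ->
  (forall x, U x -> f x = g x) -> smooth U f -> smooth U g.
Proof. by move=> oU fg sf k; exact: diff_order_ext (sf k). Qed.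

Lemma smooth_sub (V : normedModType R) U U' (f : vec -> V) :
  U' `<=` U -> smooth U f -> smooth U' f.
Proof. by move=> UU' sf k; exact: diff_order_sub (sf k). Qed.

Lemma smooth_cst (V : normedModType R) U (a : V) : open U -> smooth U (fun=> a).
Proof. by move=> oU k; exact: diff_order_cst. Qed.

Lemma smoothD (V : normedModType R) U (f g : vec -> V) : open U ->
  smooth U f -> smooth U g -> smooth U (f \+ g).
Proof. by move=> oU sf sg k; exact: diff_orderD. Qed.

Lemma smoothM U f g : open U -> smooth U f -> smooth U g ->
  smooth U (fun x => f x * g x : R^o).
Proof. by move=> oU sf sg k; exact: diff_orderM. Qed.

Lemma smoothV U f : open U -> (forall x, U x -> f x != 0) -> smooth U f ->
  smooth U (fun x => (f x)^-1 : R^o).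
Proof. by move=> oU f0 sf k; exact: diff_orderV. Qed.

Lemma smooth_partial (V : normedModType R) U i (f : vec -> V) :
  smooth U f -> smooth U (partial i f).
Proof. by move=> sf k; exact: (sf k.+1).2. Qed.

Lemma smooth_diff (V : normedModType R) U (f : vec -> V) x :
  smooth U f -> U x -> differentiable f x.
Proof. by move=> sf; exact: (sf 1%N).1. Qed.

Lemma smooth_continuous (V : normedModType R) U (f : vec -> V) x :
  smooth U f -> U x -> {for x, continuous f}.
Proof. by move=> sf Ux; exact/differentiable_continuous/(smooth_diff sf). Qed.

Lemma diff_order_sum k U (I : Type) (r : seq I) (P : pred I) (F : I -> vec -> R^o) :
  open U -> (forall i, diff_order k U (F i)) ->
  diff_order k U (fun x => \sum_(i <- r | P i) F i x : R^o).
Proof.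
move=> oU sF; elim: r => [|i r IH].
  by apply: diff_order_ext (diff_order_cst k (0 : R^o) oU) => // x _; rewrite big_nil.
have [Pi|nPi] := boolP (P i); last first.
  by apply: diff_order_ext IH => // x _; rewrite big_cons (negbTE nPi).
by apply: diff_order_ext (diff_orderD oU (sF i) IH) => // x _; rewrite big_cons Pi.
Qed.

Lemma smooth_sum U (I : Type) (r : seq I) (P : pred I) (F : I -> vec -> R^o) :
  open U -> (forall i, smooth U (F i)) ->
  smooth U (fun x => \sum_(i <- r | P i) F i x : R^o).
Proof. by move=> oU sF k; apply: diff_order_sum => // i; exact: sF. Qed.

Lemma smooth_prod U (I : Type) (r : seq I) (P : pred I) (F : I -> vec -> R^o) :
  open U -> (forall i, smooth U (F i)) ->
  smooth U (fun x => \prod_(i <- r | P i) F i x : R^o).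
Proof.
move=> oU sF; elim: r => [|i r IH].
  by apply: smooth_ext (smooth_cst (1 : R^o) oU) => // x _; rewrite big_nil.
have [Pi|nPi] := boolP (P i); last first.
  by apply: smooth_ext IH => // x _; rewrite big_cons (negbTE nPi).
by apply: smooth_ext (smoothM oU (sF i) IH) => // x _; rewrite big_cons Pi.
Qed.

End Smoothness.

(** * Symmetry of second derivatives and propagation of zeros *)

Section MixedPartials.
Variables (R : realType) (n : nat).
Local Notation vec := 'rV[R]_n.
Implicit Types (U : set vec) (x : vec) (f g : vec -> R^o).

Lemma derive_sum_partial (V : normedModType R) (f : vec -> V) x (v : vec) : differentiable f x ->
  'D_v f x = \sum_i v 0 i *: partial i f x.
Proof.
move=> df; rewrite deriveE// {1}(row_sum_delta v) linear_sum.
by apply: eq_bigr => i _; rewrite linearZ /= partialE.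
Qed.

Lemma is_derive_line f (y v : vec) (t : R) : differentiable f (y + t *: v) ->
  is_derive t 1 (fun s : R => f (y + s *: v) : R) ('D_v f (y + t *: v)).
Proof.
move=> df; pose l (s : R^o) : vec := y + s *: v.
have dl : is_diff (t : R^o) l (fun s => s *: v).
  by apply: is_diff_eq; rewrite add0r.
have dfl : differentiable (f \o l) (t : R^o) by apply: differentiable_comp.
apply: DeriveDef; first exact/derivable1_diffP.
rewrite (deriveE (f := f \o l) 1 dfl) diff_comp//= deriveE//.
by rewrite [X in 'd f _ X](_ : _ = v)// diff_val scale1r.
Qed.

Lemma norm_scale_delta (i : 'I_n) (s : R) : `|s *: delta_mx 0 i : vec| <= `|s|.
Proof.
rewrite normrZ ler_piMr// [`|_|]mx_normrE.
by apply: bigmax_le => // -[a b] _; rewrite mxE /=; case: andb; rewrite ?normr1 ?normr0.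
Qed.

(** The mean value theorem in direction [i], applied to the increment of [f] along direction [j],
    and then in direction [j], applied to [partial i f]. The left-hand side is symmetric in [i] and
    [j], so exchanging them gives the other mixed derivative. *)
Lemma second_difference_mixed f (i j : 'I_n) x (h : R) U : 0 <= h -> smooth U f ->
  (forall s t : R, 0 <= s <= h -> 0 <= t <= h ->
     U (x + t *: delta_mx 0 j + s *: delta_mx 0 i)) ->
  exists s t : R, [/\ 0 <= s <= h, 0 <= t <= h &
    (f (x + h *: delta_mx 0 j + h *: delta_mx 0 i) - f (x + h *: delta_mx 0 i))
    - (f (x + h *: delta_mx 0 j) - f x) =
    h * h * partial j (partial i f) (x + t *: delta_mx 0 j + s *: delta_mx 0 i)].
Proof.
move=> h0 sf Ub; set ei := delta_mx 0 i; set ej := delta_mx 0 j.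
have hh : 0 <= h <= h by rewrite h0 lexx.
have zh : (0 : R) <= 0 <= h by rewrite lexx.
have Ux s : 0 <= s <= h -> U (x + s *: ei).
  by move=> sh; rewrite -[x](addr0) -(scale0r ej); exact: Ub.
pose u s : R := f (x + h *: ej + s *: ei) - f (x + s *: ei).
pose du s : R := partial i f (x + h *: ej + s *: ei) - partial i f (x + s *: ei).
have udu (s : R) : 0 <= s <= h -> is_derive s (1 : R) u (du s).
  move=> sh.
  have d1 := is_derive_line (smooth_diff sf (Ub s h sh hh)).
  have d2 := is_derive_line (smooth_diff sf (Ux s sh)).
  exact: is_deriveB.
have cu : {within `[0, h], continuous u}.
  apply: derivable_within_continuous => s; rewrite in_itv /= => sh.
  by have [] := udu s sh.
have [s|s] := MVT_segment (df := du) h0 _ cu.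
  by rewrite in_itv /= => /andP[/ltW s0 /ltW sh]; apply: udu; rewrite s0.
rewrite in_itv /= subr0 => sh uE.
pose w t : R := partial i f (x + s *: ei + t *: ej).
pose dw t : R := partial j (partial i f) (x + s *: ei + t *: ej).
have wdw (t : R) : 0 <= t <= h -> is_derive t (1 : R) w (dw t).
  move=> th; apply: is_derive_line; apply: (smooth_diff (smooth_partial i sf)).
  by rewrite addrAC; exact: Ub.
have cw : {within `[0, h], continuous w}.
  apply: derivable_within_continuous => t; rewrite in_itv /= => th.
  by have [] := wdw t th.
have [t|t] := MVT_segment (df := dw) h0 _ cw.
  by rewrite in_itv /= => /andP[/ltW t0 /ltW th]; apply: wdw; rewrite t0.
rewrite in_itv /= subr0 => th wE.
exists s, t; split => //.
move: uE wE; rewrite /u /du /w /dw !scale0r !addr0 => ->.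
by rewrite addrAC => ->; rewrite [in RHS]addrAC mulrC mulrA mulrAC.
Qed.

Lemma ball_close2 (F G : vec -> R^o) x U (e : R) : open U -> U x ->
  {for x, continuous F} -> {for x, continuous G} -> 0 < e ->
  exists2 r : R, 0 < r & forall y, ball x r y ->
    [/\ U y, `|F x - F y| < e & `|G x - G y| < e].
Proof.
move=> oU Ux cF cG e0.
have /nbhs_ballP[r /= r0 rP] : \forall y \near x,
    [/\ U y, `|F x - F y| < e & `|G x - G y| < e].
  near=> y; split; near: y.
  - exact: open_nbhs_nbhs.
  - exact: ((cvgrPdist_lt _ _).1 cF).
  - exact: ((cvgrPdist_lt _ _).1 cG).
by exists r.
Unshelve. all: by end_near. Qed.

(** The second difference over a small square is its area times either mixed derivative, taken at
    points where continuity makes both close to their values at [x]. *)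
Lemma partialC U f (i j : 'I_n) x : open U -> smooth U f -> U x ->
  partial i (partial j f) x = partial j (partial i f) x.
Proof.
move=> oU sf Ux; apply/eqP; rewrite -subr_eq0 -normr_le0; apply/ler_addgt0Pr => e e0.
rewrite add0r.
have triangle (a b a' b' : R) : b' = a' ->
    `|a - a'| < e / 2 -> `|b - b'| < e / 2 -> `|a - b| <= e.
  move=> E Ha Hb; have -> : a - b = (a - a') - (b - b') by rewrite E; ring.
  by rewrite (le_trans (ler_normB _ _))// (splitr e) lerD// ltW.
have e20 : 0 < e / 2 by rewrite divr_gt0.
have [r r0 rP] := ball_close2 oU Ux
  (smooth_continuous (smooth_partial i (smooth_partial j sf)) Ux)
  (smooth_continuous (smooth_partial j (smooth_partial i sf)) Ux) e20.
(* With side r/3, every point of the square is at distance at most 2r/3 < r from [x]. *)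
have h0 : 0 <= r / 3 by rewrite divr_ge0// ltW.
have inb (k l : 'I_n) (s t : R) : 0 <= s <= r / 3 -> 0 <= t <= r / 3 ->
   ball x r (x + t *: delta_mx 0 l + s *: delta_mx 0 k).
  move=> /andP[s0 sr] /andP[t0 tr]; rewrite -ball_normE /= -addrA opprD addrA subrr sub0r normrN.
  rewrite (le_lt_trans (ler_normD _ _))//.
  rewrite (le_lt_trans (lerD (norm_scale_delta _ _) (norm_scale_delta _ _)))//.
  by rewrite !ger0_norm//; lra.
have inU k l s t (hs : 0 <= s <= r / 3) (ht : 0 <= t <= r / 3) :
    U (x + t *: delta_mx 0 l + s *: delta_mx 0 k).
  by have [] := rP _ (inb k l s t hs ht).
have [s [t [sh th E1]]] := second_difference_mixed h0 sf (inU i j).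
have [s' [t' [sh' th' E2]]] := second_difference_mixed h0 sf (inU j i).
have {E1 E2} : partial j (partial i f) (x + t *: delta_mx 0 j + s *: delta_mx 0 i) =
  partial i (partial j f) (x + t' *: delta_mx 0 i + s' *: delta_mx 0 j).
  have hh : r / 3 * (r / 3) != 0 by rewrite mulf_neq0// gt_eqF// divr_gt0.
  have xC : x + (r / 3) *: delta_mx 0 i + (r / 3) *: delta_mx 0 j =
    x + (r / 3) *: delta_mx 0 j + (r / 3) *: delta_mx 0 i by rewrite addrAC.
  rewrite xC in E2; move: E1 E2.
  move: (partial j _ _) (partial i _ _) (f _) (f _) (f _) (f _) => b' a' P Q S T E1 E2.
  by apply: (mulfI hh); rewrite -E1 -E2; ring.
have [_ _ H2] := rP _ (inb i j s t sh th).
have [_ H1 _] := rP _ (inb j i s' t' sh' th').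
move=> E; apply: triangle E H1 H2.
Qed.

(* The maximum of |f| on a segment issuing from a zero is, by the mean value
   theorem, at most half of itself if the segment is short. *)
Lemma zero_near U f (phi : 'I_n -> vec -> R) x : open U ->
  (forall y, U y -> differentiable f y) ->
  (forall i y, U y -> {for y, continuous (phi i)}) ->
  (forall i y, U y -> partial i f y = phi i y * f y) ->
  U x -> f x = 0 -> \near x, f x = 0.
Proof.
move=> oU df cphi dfE Ux fx0.
pose S (y : vec) : R := \sum_i `|phi i y|.
have cS : S y @[y --> x] --> S x.
  have FF : Filter (nbhs x) by exact: nbhs_filter.
  apply: cvg_big => [|i _]; first exact: add_continuous.
  by apply: cvg_norm; exact: cphi.
pose K : R := S x + 1.
have K0 : 0 < K by rewrite ltr_wpDl// sumr_ge0.
have SK : \near x, S x < K by apply: (cvgr_lt _ cS); rewrite /K ltrDl.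
have /nbhs_ballP[r /= r0 rP] : nbhs x [set y | U y /\ S y < K].
  by apply: filterI => //; exact: open_nbhs_nbhs.
(* On this ball [K] bounds the sum of the |phi i|, and |v| K < 1/2: this is the origin of the factor
   one half. *)
apply/nbhs_ballP; exists (Num.min r (2 * K)^-1) => /=.
  by rewrite lt_min r0 invr_gt0 mulr_gt0.
move=> y; rewrite -ball_normE /= lt_min distrC => /andP[yr yK].
pose v : vec := y - x; rewrite -/v in yr yK.
have inb (t : R) : 0 <= t <= 1 -> ball x r (x + t *: v).
  move=> /andP[t0 t1]; rewrite -ball_normE /= opprD addrA subrr sub0r normrN normrZ.
  by rewrite (le_lt_trans _ yr)// ger0_norm// ler_piMl.
pose F t : R := f (x + t *: v).
pose dF t : R := 'D_v f (x + t *: v).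
have FdF (t : R) : 0 <= t <= 1 -> is_derive t (1 : R) F (dF t).
  by move=> t01; apply: is_derive_line; apply: df; have [] := rP _ (inb _ t01).
have cF : {within `[0, 1], continuous F}.
  apply: derivable_within_continuous => s; rewrite in_itv /= => sh.
  by have [] := FdF s sh.
have cnF : {within `[0, 1], continuous (fun t => `|F t|)}.
  by move=> t; apply: cvg_norm; exact: cF.
have [c c01 maxc] := EVT_max ler01 cnF.
have /andP[c0 c1] : 0 <= c <= 1 by rewrite in_itv in c01.
have cFc : {within `[0, c], continuous F}.
  apply: derivable_within_continuous => s; rewrite in_itv /= => /andP[s0 sh].
  by have [] : is_derive s (1 : R) F (dF s) by apply: FdF; rewrite s0 (le_trans sh).
have [s|s] := MVT_segment (df := dF) c0 _ cFc.
  rewrite in_itv /= => /andP[/ltW s0 /ltW sc]; apply: FdF.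
  by rewrite s0 (le_trans sc).
rewrite in_itv /= subr0 => /andP[s0 sc] Fc.
have F0 : F 0 = 0 by rewrite /F scale0r addr0.
have s01 : 0 <= s <= 1 by rewrite s0 (le_trans sc).
have [Us Ss] := rP _ (inb _ s01).
have dFs : `|dF s| <= 2^-1 * `|F s|.
  rewrite /dF derive_sum_partial; last exact: df.
  under eq_bigr => i _ do rewrite dfE//.
  rewrite (le_trans (ler_norm_sum _ _ _))//.
  apply: (@le_trans _ _ (\sum_i `|v| * `|phi i (x + s *: v)| * `|F s|)).
    apply: ler_sum => i _; rewrite -[X in X <= _]/(`|v 0 i * (phi i (x + s *: v) * F s)| : R).
    rewrite !normrM mulrA !ler_wpM2r//.
    rewrite [leRHS]mx_normrE.
    exact: (le_bigmax _ (fun i : 'I_1 * 'I_n => `|v i.1 i.2|) (0, i)).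
  rewrite -mulr_suml -mulr_sumr ler_wpM2r//.
  apply: (@le_trans _ _ ((2 * K)^-1 * K)).
    by apply: ler_pM => //; rewrite ?sumr_ge0// ltW.
  by rewrite invfM -mulrA mulVf ?mulr1// gt_eqF.
have Fsc : `|F s| <= `|F c| by apply: maxc; rewrite in_itv.
have Fc0 : `|F c| <= 2^-1 * `|F c|.
  rewrite -{1}[F c]subr0 -F0 Fc normrM (ger0_norm c0) (le_trans (ler_piMr _ c1))//.
  by rewrite (le_trans dFs)// ler_wpM2l// invr_ge0.
have {}Fc0 : `|F c| <= 0 by move: Fc0; set z := `|F c|; lra.
have : `|F 1| <= 0 by rewrite (le_trans _ Fc0)// maxc// in_itv /= ler01 lexx.
by rewrite normr_le0 => /eqP; rewrite /F scale1r /v addrC subrK.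
Qed.

End MixedPartials.

(** * Calculus of matrix-valued functions *)

(* Locked because unification would otherwise unfold it down to limits. *)
HB.lock Definition dmx (R : realType) (n p q : nat) (l : 'I_n)
    (F : 'rV[R]_n -> 'M[R]_(p, q)) (x : 'rV[R]_n) : 'M[R]_(p, q) :=
  \matrix_(i, j) partial l (fun y => F y i j : R^o) x.

Section MatrixCalculus.
Variables (R : realType) (n : nat).
Local Notation vec := 'rV[R]_n.
Implicit Types (U : set vec) (x : vec).

(* Matrix-valued functions are handled entrywise; [smooth_mxP] and
   [partial_mx] relate this to the normed space of matrices. *)
Definition msmooth p q U (F : vec -> 'M[R]_(p, q)) : Prop :=
  forall i j, smooth U (fun x => F x i j : R^o).

Lemma dmxE p q l (F : vec -> 'M[R]_(p, q)) x i j :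
  dmx l F x i j = partial l (fun y => F y i j : R^o) x.
Proof. by rewrite unlock mxE. Qed.

Lemma eq_partial (V : normedModType R) l (f g : vec -> V) x :
  f =1 g -> partial l f x = partial l g x.
Proof. by move=> /funext ->. Qed.

Lemma partial_mx p q l (F : vec -> 'M[R]_(p, q)) x :
  differentiable F x -> partial l F x = dmx l F x.
Proof.
by move=> dF; rewrite unlock /partial derive_mx//; exact: diff_derivable.
Qed.

Lemma differentiable_entry p q (F : vec -> 'M[R]_(p, q)) x i j :
  differentiable F x -> differentiable (fun y => F y i j : R^o) x.
Proof.
move=> dF.
exact: (differentiable_comp dF (differentiable_coord (F x) i j)).
Qed.

Lemma differentiable_mx p q (F : vec -> 'M[R]_(p, q)) x :
  (forall i j, differentiable (fun y => F y i j : R^o) x) -> differentiable F x.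
Proof.
move=> dF; have -> : F = \sum_(i < p) \sum_(j < q) (fun y => F y i j *: delta_mx i j).
  apply/funext => y; rewrite [LHS]matrix_sum_delta fct_sumE.
  by apply: eq_bigr => i _; rewrite fct_sumE.
apply: differentiable_sum => i; apply: differentiable_sum => j.
exact: differentiableZl.
Qed.

Lemma smooth_mxP p q U (F : vec -> 'M[R]_(p, q)) : open U ->
  smooth U F <-> msmooth U F.
Proof.
move=> oU; split => [sF i j k|sF k].
  move: (sF k); elim: k F {sF} => // k IH F [dF pF].
  split=> [x Ux|l]; first exact/differentiable_entry/dF.
  apply: (diff_order_ext oU _ (IH _ (pF l))) => x Ux.
  by rewrite partial_mx ?dmxE//; exact: dF.
have {}sF i j : diff_order k U (fun x => F x i j : R^o) by exact: sF.
elim: k F sF => // k IH F sF; have dF x : U x -> differentiable F x.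
  by move=> Ux; apply: differentiable_mx => i j; exact: (sF i j).1.
split=> // l; apply: IH => i j.
apply: (diff_order_ext oU _ ((sF i j).2 l)) => x Ux.
by rewrite partial_mx ?dmxE//; exact: dF.
Qed.

Lemma msmooth_ext p q U (F G : vec -> 'M[R]_(p, q)) : open U ->
  (forall x, U x -> F x = G x) -> msmooth U F -> msmooth U G.
Proof. by move=> oU FG sF i j; apply: smooth_ext (sF i j) => // x /FG ->. Qed.

Lemma msmooth_sub p q U U' (F : vec -> 'M[R]_(p, q)) :
  U' `<=` U -> msmooth U F -> msmooth U' F.
Proof. by move=> UU' sF i j; exact: smooth_sub (sF i j). Qed.

Lemma msmooth_cst p q U (A : 'M[R]_(p, q)) : open U -> msmooth U (fun=> A).
Proof. by move=> oU i j; exact: smooth_cst. Qed.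

Lemma msmoothD p q U (F G : vec -> 'M[R]_(p, q)) : open U ->
  msmooth U F -> msmooth U G -> msmooth U (fun x => F x + G x).
Proof.
move=> oU sF sG i j; apply: smooth_ext (smoothD oU (sF i j) (sG i j)) => // x _.
by rewrite mxE.
Qed.

Lemma msmoothZ p q U (k : vec -> R^o) (F : vec -> 'M[R]_(p, q)) : open U ->
  smooth U k -> msmooth U F -> msmooth U (fun x => k x *: F x).
Proof.
move=> oU sk sF i j; apply: smooth_ext (smoothM oU sk (sF i j)) => // x _.
by rewrite mxE.
Qed.

Lemma msmoothN p q U (F : vec -> 'M[R]_(p, q)) : open U ->
  msmooth U F -> msmooth U (fun x => - F x).
Proof.
move=> oU sF; apply: msmooth_ext (msmoothZ oU (smooth_cst (-1 : R^o) oU) sF) => // x _.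
by rewrite scaleN1r.
Qed.

Lemma msmoothB p q U (F G : vec -> 'M[R]_(p, q)) : open U ->
  msmooth U F -> msmooth U G -> msmooth U (fun x => F x - G x).
Proof. by move=> oU sF sG; apply: msmoothD => //; exact: msmoothN. Qed.

Lemma msmoothM p q r U (F : vec -> 'M[R]_(p, q)) (G : vec -> 'M[R]_(q, r)) : open U ->
  msmooth U F -> msmooth U G -> msmooth U (fun x => F x *m G x).
Proof.
move=> oU sF sG i j.
have := @smooth_sum _ _ U 'I_q (index_enum _) xpredT
  (fun k x => F x i k * G x k j : R^o) oU
  (fun k => smoothM oU (sF i k) (sG k j)).
by apply: smooth_ext => // x _; rewrite mxE.
Qed.

Lemma msmoothT p q U (F : vec -> 'M[R]_(p, q)) :
  msmooth U F -> msmooth U (fun x => (F x)^T).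
Proof.
by move=> sF i j; rewrite (_ : (fun x => _) = (fun x => F x j i))//; apply/funext => x; rewrite mxE.
Qed.

Lemma msmooth_sum p q U (I : Type) (r : seq I) (P : pred I)
    (F : I -> vec -> 'M[R]_(p, q)) : open U ->
  (forall i, msmooth U (F i)) -> msmooth U (fun x => \sum_(i <- r | P i) F i x).
Proof.
move=> oU sF i j.
have := @smooth_sum _ _ U I r P (fun k x => F k x i j : R^o) oU (fun k => sF k i j).
by apply: smooth_ext => // x _; rewrite summxE.
Qed.

Lemma msmooth_dmx p q U l (F : vec -> 'M[R]_(p, q)) :
  open U -> msmooth U F -> msmooth U (dmx l F).
Proof.
by move=> oU sF i j; apply: smooth_ext (smooth_partial l (sF i j)) => // x _; rewrite dmxE.
Qed.

Lemma smooth_det p U (F : vec -> 'M[R]_p) : open U -> msmooth U F ->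
  smooth U (fun x => \det (F x) : R^o).
Proof.
move=> oU sF; apply: smooth_sum => // s; apply: smoothM => //.
  exact: smooth_cst.
by apply: smooth_prod.
Qed.

Lemma smooth_tr p U (F : vec -> 'M[R]_p) : open U -> msmooth U F ->
  smooth U (fun x => \tr (F x) : R^o).
Proof. by move=> oU sF; apply: smooth_sum. Qed.

Lemma msmoothV p U (F : vec -> 'M[R]_p) : open U ->
  (forall x, U x -> F x \in unitmx) ->
  msmooth U F -> msmooth U (fun x => invmx (F x)).
Proof.
move=> oU uF sF.
have sadj : msmooth U (fun x => \adj (F x)).
  move=> i j; rewrite (_ : (fun x => _) = (fun x => (-1) ^+ (j + i) *
      \det (row' j (col' i (F x))) : R^o)); last by apply/funext => x; rewrite mxE.
  apply: smoothM => //; first exact: smooth_cst.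
  apply: smooth_det => // a b; rewrite (_ : (fun x => _) = (fun x => F x (lift j a) (lift i b)))//.
  by apply/funext => x; rewrite !mxE.
have sdet : smooth U (fun x => (\det (F x))^-1 : R^o).
  apply: smoothV => //; last exact: smooth_det.
  by move=> x Ux; have := uF x Ux; rewrite unitmxE unitfE.
apply: msmooth_ext (msmoothZ oU sdet sadj) => // x Ux.
by rewrite /invmx uF.
Qed.

Lemma msmooth_entry_diff p q U (F : vec -> 'M[R]_(p, q)) x i j :
  msmooth U F -> U x -> differentiable (fun y => F y i j : R^o) x.
Proof. by move=> sF Ux; exact: (smooth_diff (sF i j)). Qed.

Lemma dmx_ext p q U l (F G : vec -> 'M[R]_(p, q)) x : open U ->
  (forall x, U x -> F x = G x) -> U x -> dmx l F x = dmx l G x.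
Proof.
move=> oU FG Ux; apply/matrixP => i j; rewrite ?(mxE, dmxE).
by apply: partial_near_eq; apply: near_open oU _ _ Ux => y /FG ->.
Qed.

Lemma dmxT p q l (F : vec -> 'M[R]_(p, q)) x :
  dmx l (fun y => (F y)^T) x = (dmx l F x)^T.
Proof.
apply/matrixP => i j; rewrite ?(mxE, dmxE); apply: eq_partial => y.
by rewrite mxE.
Qed.

Lemma partial_sum l m (h : 'I_m -> vec -> R^o) x : (forall i, differentiable (h i) x) ->
  partial l (fun y => \sum_i h i y : R^o) x = \sum_i partial l (h i) x.
Proof.
move=> dh; rewrite -[RHS]derive_sum; last by move=> i; exact: diff_derivable.
by apply: eq_partial => y; rewrite fct_sumE.
Qed.

Section Rules.
Variables (U : set vec) (x : vec).
Hypothesis Ux : U x.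

Lemma dmxD p q l (F G : vec -> 'M[R]_(p, q)) : msmooth U F -> msmooth U G ->
  dmx l (fun y => F y + G y) x = dmx l F x + dmx l G x.
Proof.
move=> sF sG; apply/matrixP => i j; rewrite ?(mxE, dmxE) -partialD.
- by apply: eq_partial => y; rewrite mxE.
- exact: msmooth_entry_diff sF _.
- exact: msmooth_entry_diff sG _.
Qed.

Lemma dmxZ p q l (k : vec -> R^o) (F : vec -> 'M[R]_(p, q)) : smooth U k -> msmooth U F ->
  dmx l (fun y => k y *: F y) x = partial l k x *: F x + k x *: dmx l F x.
Proof.
move=> sk sF; apply/matrixP => i j; rewrite ?(mxE, dmxE) addrC [_ * F x i j]mulrC -partialM.
- by apply: eq_partial => y; rewrite mxE.
- exact: smooth_diff sk _.
- exact: msmooth_entry_diff sF _.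
Qed.

Lemma dmxN p q l (F : vec -> 'M[R]_(p, q)) : msmooth U F ->
  dmx l (fun y => - F y) x = - dmx l F x.
Proof.
move=> sF; apply/matrixP => i j; rewrite ?(mxE, dmxE) -[RHS]mulN1r -[RHS]partialZ.
  by apply: eq_partial => y; rewrite mxE -[LHS]mulN1r.
exact: msmooth_entry_diff sF _.
Qed.

Lemma dmxM p q r l (F : vec -> 'M[R]_(p, q)) (G : vec -> 'M[R]_(q, r)) :
  msmooth U F -> msmooth U G ->
  dmx l (fun y => F y *m G y) x = dmx l F x *m G x + F x *m dmx l G x.
Proof.
move=> sF sG; apply/matrixP => i j; rewrite ?(mxE, dmxE) -big_split /=.
rewrite (_ : (fun y => _) = (fun y => \sum_k F y i k * G y k j : R^o)); last first.
  by apply/funext => y; rewrite mxE.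
rewrite partial_sum => [|k]; last first.
  apply: differentiableM; first exact: msmooth_entry_diff sF _.
  exact: msmooth_entry_diff sG _.
apply: eq_bigr => k _; rewrite ?(mxE, dmxE) partialM; last 2 first.
- exact: msmooth_entry_diff sF _.
- exact: msmooth_entry_diff sG _.
by rewrite addrC; congr (_ + _); exact: mulrC.
Qed.

Lemma dmx_sum p q l m (F : 'I_m -> vec -> 'M[R]_(p, q)) : (forall i, msmooth U (F i)) ->
  dmx l (fun y => \sum_i F i y) x = \sum_i dmx l (F i) x.
Proof.
move=> sF; apply/matrixP => i j; rewrite ?(mxE, dmxE) summxE.
under [RHS]eq_bigr do rewrite dmxE.
rewrite -partial_sum => [|k]; last exact: msmooth_entry_diff (sF k) _.
by apply: eq_partial => y; rewrite summxE.
Qed.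

Lemma dmxC p q k l (F : vec -> 'M[R]_(p, q)) : open U -> msmooth U F ->
  dmx k (dmx l F) x = dmx l (dmx k F) x.
Proof.
move=> oU sF.
apply/matrixP => i j.
rewrite (dmxE k (dmx l F)).
rewrite (dmxE l (dmx k F)).
have E m : (fun y => dmx m F y i j) = partial m (fun y => F y i j : R^o).
  by apply/funext => y; rewrite dmxE.
rewrite (E l) (E k).
exact: (partialC k l oU (sF i j) Ux).
Qed.

Lemma partial_tr p l (F : vec -> 'M[R]_p) : msmooth U F ->
  partial l (fun y => \tr (F y) : R^o) x = \tr (dmx l F x).
Proof.
move=> sF; rewrite partial_sum => [|k]; last exact: msmooth_entry_diff sF _.
by apply: eq_bigr => k _; rewrite dmxE.
Qed.

End Rules.

End MatrixCalculus.

(** * Chain rule *)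

Section ChainRule.
Variables (R : realType) (n : nat).
Local Notation vec := 'rV[R]_n.
Variables (t : vec -> vec) (W : set vec).
Hypotheses (oW : open W) (st : smooth W t).

Lemma partial_comp l (f : vec -> R^o) x : W x -> differentiable f (t x) ->
  partial l (fun y => f (t y) : R^o) x =
  \sum_a partial l t x 0 a * partial a f (t x).
Proof.
move=> Wx df; have dt := smooth_diff st Wx.
rewrite partialE; last exact: differentiable_comp.
rewrite [in LHS](diff_comp dt df) /= -deriveE// derive_sum_partial//.
by apply: eq_bigr => a _; rewrite -partialE.
Qed.

Lemma smooth_comp V (f : vec -> R^o) : (forall x, W x -> V (t x)) -> smooth V f ->
  smooth W (fun y => f (t y) : R^o).
Proof.
move=> tV sf k; elim: k f sf => // k IH f sf; split.
  move=> x Wx; apply: differentiable_comp; first exact: smooth_diff st _.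
  by apply: smooth_diff sf _; exact: tV.
move=> l; have h : diff_order k W (fun x => \sum_a partial l t x 0 a * partial a f (t x) : R^o).
  have sm a : diff_order k W (fun x => partial l t x 0 a * partial a f (t x) : R^o).
    apply: diff_orderM => //; last by apply: IH; exact: smooth_partial.
    by apply: ((smooth_mxP _ oW).1 (smooth_partial l st)).
  exact: diff_order_sum.
apply: (diff_order_ext oW _ h) => x Wx.
by rewrite partial_comp//; apply: smooth_diff sf _; exact: tV.
Qed.

Lemma msmooth_comp p q V (F : vec -> 'M[R]_(p, q)) : (forall x, W x -> V (t x)) ->
  msmooth V F -> msmooth W (fun y => F (t y)).
Proof. by move=> tV sF i j; exact: (smooth_comp tV (sF i j)). Qed.

Lemma dmx_comp p q V l (F : vec -> 'M[R]_(p, q)) x : W x -> V (t x) -> msmooth V F ->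
  dmx l (fun y => F (t y)) x = \sum_a partial l t x 0 a *: dmx a F (t x).
Proof.
move=> Wx Vx sF; apply/matrixP => i j; rewrite ?(mxE, dmxE) summxE.
rewrite (partial_comp l Wx (smooth_diff (sF i j) Vx)).
by apply: eq_bigr => a _; rewrite ?(mxE, dmxE).
Qed.

End ChainRule.

(** * Matrix algebra *)

(** Unlike [mxE], these rules stop at products, whose entries thus stay atoms for [ring]. *)
Lemma mx_linE (R : pzRingType) p q :
  ((forall (A B : 'M[R]_(p, q)) i j, ((A + B) i j = A i j + B i j)%R) *
   (forall (A : 'M[R]_(p, q)) i j, ((- A) i j = - A i j)%R) *
   (forall i j, (0 : 'M[R]_(p, q)) i j = 0%R) *
   (forall k (A : 'M[R]_(p, q)) i j, ((k *: A) i j = k * A i j)%R))%type.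
Proof. by split; [split; [split|]|] => *; rewrite mxE. Qed.

Lemma mulmx_entry (R : pzSemiRingType) p q r (A : 'M[R]_(p, q)) (B : 'M[R]_(q, r)) i k :
  (A *m B) i k = \sum_j A i j * B j k.
Proof. exact: mxE. Qed.

Lemma trmx_addE (R : pzRingType) p q :
  ((forall A B : 'M[R]_(p, q), (A + B)^T = (A^T + B^T)%R) *
   (forall A : 'M[R]_(p, q), (- A)^T = (- A^T)%R))%type.
Proof. by split => *; apply/matrixP => i j; rewrite !mxE. Qed.

(* Identities between noncommutative polynomials in matrices: after expansion,
   the entries of the monomials are atoms for [ring]. *)
Ltac mx_noncomm :=
  apply/matrixP => ? ?;
  rewrite ?(mulmxDl, mulmxDr, mulNmx, mulmxN, mulmxA, =^~ scalemxAl, =^~ scalemxAr)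
    ?mx_linE; ring.

(** * Positive definite forms and tensors of rank one *)

Section PositiveDefinite.
Variable (R : rcfType).

Definition posdef n (G : 'M[R]_n) : Prop :=
  G^T = G /\ forall v : 'rV[R]_n, v != 0 -> 0 < (v *m G *m v^T) 0 0.

Lemma posdef_unit n (G : 'M[R]_n) : posdef G -> G \in unitmx.
Proof.
move=> [_ G0]; rewrite -row_free_unit -kermx_eq0; apply/eqP/row_matrixP => i.
rewrite row0; apply/eqP; apply: contraT => /G0.
by rewrite -row_mul mulmx_ker row0 mul0mx mxE ltxx.
Qed.

Lemma orthonormal_frame n (G : 'M[R]_n) : posdef G ->
  exists P : 'M[R]_n, P *m G *m P^T = 1%:M.
Proof.
elim: n G => [|n IH] G [Gs G0]; first by exists 1%:M; rewrite !flatmx0; apply: flatmx0.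
pose G' : 'M[R]_(1 + n) := G; pose a := G 0 0.
have a0 : 0 < a.
  have := G0 (delta_mx 0 0); rewrite -rowE trmx_delta -colE !mxE; apply.
  by apply/eqP => /matrixP/(_ 0 0)/eqP; rewrite !mxE !eqxx oner_eq0.
pose r : 'rV_n := ursubmx G'; pose H : 'M[R]_n := drsubmx G'.
have GE : G' = block_mx a%:M r r^T H.
  rewrite -[LHS]submxK; congr block_mx.
    by rewrite [LHS]mx11_scalar !mxE; congr ((G _ _)%:M); exact/val_inj.
  by rewrite trmx_ursub /G' Gs.
have Hs : H^T = H by rewrite /H trmx_drsub /G' Gs.
(* The Schur complement of the corner [a]: the form induced on the orthogonal complement of the
   first basis vector. *)
pose H' := H - a^-1 *: (r^T *m r).
have [Q QH] : exists Q : 'M[R]_n, Q *m H' *m Q^T = 1%:M.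
  apply: IH; split.
    by rewrite /H' linearB /= linearZ /= trmx_mul trmxK Hs.
  (* [y] is the lift of [v] that is orthogonal to the first basis vector. *)
  move=> v v0; pose y : 'rV_(1 + n) := row_mx (- a^-1 *: (v *m r^T)) v.
  have y0 : y != 0.
    by apply: contra v0 => /eqP yz; rewrite -[v](row_mxKr (- a^-1 *: (v *m r^T))) -/y yz linear0.
  suff <- : y *m G' *m y^T = v *m H' *m v^T by exact: G0.
  rewrite GE /y mul_row_block tr_row_mx mul_row_col.
  rewrite -!scalemxAl mul_mx_scalar scalerA mulNr mulVf ?gt_eqF// scaleN1r addNr mul0mx add0r.
  rewrite /H' mulmxBr -scalemxAr mulmxA; congr (_ *m _).
  by rewrite addrC -scaleNr.
pose s := Num.sqrt a.
have ss : s * s = a by rewrite -expr2 sqr_sqrtr// ltW.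
have s0 : s != 0 by rewrite gt_eqF// sqrtr_gt0.
(* The first basis vector divided by its length, and the rows of [Q] lifted in the same way as [v]
   above. *)
pose P : 'M[R]_(1 + n) := block_mx (s^-1)%:M 0 (- a^-1 *: (Q *m r^T)) Q.
exists P; change (P *m G' *m P^T = 1%:M); rewrite GE /P tr_block_mx mulmx_block mulmx_block.
rewrite !mul0mx !addr0 trmx0 !mulmx0 !addr0.
have E1 : (- a^-1 *: (Q *m r^T)) *m a%:M + Q *m r^T = 0.
  by rewrite mul_mx_scalar scalerA mulrN mulfV ?gt_eqF// scaleN1r addNr.
have E2 : a%:M *m (- a^-1 *: (Q *m r^T))^T + r *m Q^T = 0.
  by rewrite -[LHS]trmxK linearD /= !trmx_mul !trmxK tr_scalar_mx E1 trmx0.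
have E3 : (- a^-1 *: (Q *m r^T)) *m r + Q *m H = Q *m H'.
  by rewrite /H' mulmxBr -scalemxAr mulmxA -scalemxAl scaleNr addrC.
rewrite E1 E3 QH !mul0mx add0r -!mulmxA -mulmxDr E2 mulmx0.
rewrite tr_scalar_mx -!scalar_mxM.
have -> : s^-1 * (a * s^-1) = 1 by rewrite -ss mulfK// mulVf.
exact: (esym (scalar_mx_block 1 n 1)).
Qed.

(** In an orthonormal frame [X] becomes a symmetric matrix, and the trace of its square is the sum
    of the squares of its entries. *)
Lemma mxtrace_sqr_eq0 n (G X : 'M[R]_n) : posdef G -> (X *m G)^T = X *m G ->
  \tr (X *m X) = 0 -> X = 0.
Proof.
move=> pG XGs trX; have [P PG] := orthonormal_frame pG.
have [_ uGP] := mulmx1_unit PG; have [uP _] := mulmx1_unit PG.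
have KP : G *m P^T *m P = 1%:M by apply: mulmx1C; rewrite mulmxA.
have uP' : P \in unitmx by move: uP; rewrite unitmx_mul => /andP[].
have [K KE] : exists K, K = G *m P^T by eexists.
rewrite -KE in KP; pose Y := P *m (X *m K).
have Ys : Y^T = Y.
  by rewrite /Y KE (mulmxA X) mulmxA !trmx_mul trmxK -trmx_mul XGs !mulmxA.
have trY : \tr (Y *m Y) = 0.
  have -> : Y *m Y = P *m (X *m X *m K).
    by rewrite /Y -!mulmxA (mulmxA K P) KP mul1mx.
  by rewrite mxtrace_mulC -(mulmxA _ K) KP mulmx1.
have Y0 : Y = 0.
  apply/matrixP => i j; rewrite [RHS]mxE; apply/eqP.
  have sq k l : Y k l * Y l k = Y k l ^+ 2.
    by rewrite expr2; congr (_ * _); rewrite -[in LHS]Ys mxE.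
  have sq0 k : 0 <= (Y *m Y) k k.
    by rewrite mxE; apply: sumr_ge0 => l _; rewrite sq sqr_ge0.
  move/eqP: trY; rewrite psumr_eq0// => /allP/(_ i (mem_index_enum _)).
  rewrite mxE psumr_eq0 => [/allP/(_ j (mem_index_enum _))|l _].
    by rewrite sq sqrf_eq0.
  by rewrite sq sqr_ge0.
have : invmx P *m Y *m P = 0 by rewrite Y0 mulmx0 mul0mx.
by rewrite /Y -!mulmxA mulKmx// KP mulmx1.
Qed.

(** The trace of an idempotent is its rank: cancelling the full-rank factors in [E *m E = E] gives
    [row_base E *m col_base E = 1%:M]. So [E] is a column times a row. *)
Lemma idempotent_trace1_minors n (E : 'M[R]_n) : E *m E = E -> \tr E = 1 ->
  forall i j k l, E i j * E k l = E i l * E k j.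
Proof.
move=> EE trE.
have rc : row_base E *m col_base E = 1%:M.
  apply: (row_full_inj (col_base_full E)); apply: (row_free_inj (row_base_free E)).
  by rewrite mulmx1 (mulmxA (col_base E)) (mulmx_base E) -mulmxA (mulmx_base E).
have r1 : \rank E = 1%N.
  have : \tr (col_base E *m row_base E) = 1 by rewrite mulmx_base.
  by rewrite mxtrace_mulC rc mxtrace1 => /eqP; rewrite (eqr_nat R _ 1) => /eqP.
move=> i j k l; rewrite -(mulmx_base E).
move: (col_base E) (row_base E); rewrite r1 => c r.
by rewrite !mxE !big_ord1; ring.
Qed.

(** With an index raised, [T] is [s] times an idempotent of trace one. So [T] has rank one, and any
    nonzero combination [w] of its rows determines it up to a factor. *)
Lemma rank_one_form n (G T : 'M[R]_n) (s : R) (v : 'rV[R]_n) :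
  posdef G -> T^T = T -> s != 0 ->
  T *m invmx G *m T = s *: T -> \tr (T *m invmx G) = s ->
  let w := v *m T in w != 0 ->
  T = s *: (((w *m invmx G *m w^T) 0 0)^-1 *: (w^T *m w)).
Proof.
move=> pG Ts s0 TT trT w wn0; have uG := posdef_unit pG.
pose E := s^-1 *: (T *m invmx G).
have EE : E *m E = E.
  by rewrite /E -scalemxAl -scalemxAr mulmxA TT -scalemxAl (scalerA s^-1 s) mulVf// scale1r.
have trE : \tr E = 1 by rewrite /E linearZ /= trT mulVf.
have minE := idempotent_trace1_minors EE trE.
have TE : T = s *: (E *m G) by rewrite /E -scalemxAl mulmxKV// scalerA mulfV// scale1r.
have minT a b c d : T a b * T c d = T a d * T c b.
  rewrite TE !mxE [LHS]mulrACA [RHS]mulrACA; congr (_ * _).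
  rewrite !big_distrlr /= [RHS]exchange_big /=.
  by apply: eq_bigr => x _; apply: eq_bigr => y _; rewrite mulrACA minE; ring.
have wE : w^T = T *m v^T by rewrite /w trmx_mul Ts.
(* By rank one, [w^T *m w] is [z] times [T]; as |w|^2 = s z, normalising [w] cancels [z]. *)
pose z := (v *m T *m v^T) 0 0.
have wT : w^T *m w = z *: T.
  rewrite wE /w; apply/matrixP => a d; rewrite /z !mxE big_ord1 !mxE big_distrlr /=.
  rewrite big_distrl /=; apply: eq_bigr => b _.
  rewrite (mulmx_entry v T) !big_distrl /=; apply: eq_bigr => c _; rewrite ?[v^T _ _]mxE.
  transitivity (T a b * T c d * (v 0 b * v 0 c)); first by ring.
  by rewrite minT; ring.
have nT : (w *m invmx G *m w^T) 0 0 = s * z.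
  rewrite wE /w /z -(mulmxA v) -(mulmxA v) (mulmxA (T *m _)) TT.
  by rewrite -scalemxAl -scalemxAr mxE mulmxA.
have z0 : z != 0.
  apply: contra wn0 => /eqP z0; apply/eqP/rowP => b; rewrite [RHS]mxE.
  apply/eqP; rewrite -sqrf_eq0 expr2.
  by move/matrixP/(_ b b): wT; rewrite z0 scale0r mxE big_ord1 mxE => ->; rewrite mxE.
rewrite wT nT !scalerA mulrAC divff ?scale1r//.
by rewrite mulf_neq0.
Qed.

End PositiveDefinite.

(** * Algebra of curvature tensors *)

Section CurvatureAlgebra.
Variable (R : realType).

(* [F i j] is the matrix of R(d_i, d_j): row [l], column [k] holds R^k_lij. *)
Definition ricci_of n (F : 'I_n -> 'I_n -> 'M[R]_n) : 'M[R]_n :=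
  \matrix_(l, j) \sum_k F k j l k.

Lemma ricci_of_transform n (J : 'M[R]_n) (F F' : 'I_n -> 'I_n -> 'M[R]_n) : J \in unitmx ->
  (forall i j, F i j *m J = J *m \sum_a \sum_b (J i a * J j b) *: F' a b) ->
  ricci_of F = J *m ricci_of F' *m J^T.
Proof.
move=> uJ FE; apply/matrixP => l j; rewrite !mxE.
have {}FE i m : F i m = \sum_a \sum_b (J i a * J m b) *: (J *m F' a b *m invmx J).
  rewrite -[LHS](mulmxK uJ) FE mulmx_sumr mulmx_suml; apply: eq_bigr => a _.
  rewrite mulmx_sumr mulmx_suml; apply: eq_bigr => b _.
  by rewrite -scalemxAr -scalemxAl.
under eq_bigr => k _ do rewrite FE summxE.
rewrite exchange_big /=.
under eq_bigr => a _.
  under eq_bigr => k _ do rewrite summxE.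
  rewrite exchange_big /=.
  over.
rewrite exchange_big /=; apply: eq_bigr => b _.
rewrite !mxE big_distrl /=.
under [RHS]eq_bigr => e _ do rewrite mxE big_distrr big_distrl /=.
rewrite [RHS]exchange_big /=; apply: eq_bigr => a _.
transitivity (J j b * (J *m F' a b *m invmx J *m J) l a).
  rewrite [X in _ = _ * X]mxE big_distrr /=; apply: eq_bigr => k _.
  by rewrite [LHS]mxE; ring.
rewrite mulmxKV// mxE big_distrr /=; apply: eq_bigr => e _.
by ring.
Qed.

(** The difference of the two connections, with its last index lowered, is symmetric in the first
    two indices and skew in the last two; applying these symmetries alternately changes its sign.
    The transformation law of the Christoffel symbols is derived from this uniqueness. *)
Lemma metric_connection_unique n (G : 'M[R]_n) (A A' : 'I_n -> 'M[R]_n) : G \in unitmx -> G^T = G ->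
  (forall i j k, A i j k = A j i k) -> (forall i j k, A' i j k = A' j i k) ->
  (forall i, A i *m G + (A i *m G)^T = A' i *m G + (A' i *m G)^T) ->
  forall i, A i = A' i.
Proof.
move=> uG Gs sA sA' AG i.
pose D i := (A i - A' i) *m G.
have Dsym a b c : D a b c = D b a c.
  by rewrite /D !mxE; apply: eq_bigr => m _; rewrite !mxE sA sA'.
have Dskew a b c : D a b c = - D a c b.
  apply/eqP; rewrite -addr_eq0; apply/eqP.
  have /matrixP/(_ b c) := AG a; rewrite /D mulmxBl.
  by move: (A a *m G) (A' a *m G) => X Y; rewrite !mxE => ?; lra.
have D0 : D i = 0.
  apply/matrixP => j l; rewrite [RHS]mxE.
  have : D i j l = - D i j l.
    rewrite {1}(Dsym i j l) (Dskew j i l) (Dsym j l i) (Dskew l j i) opprK.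
    by rewrite (Dsym l i j) (Dskew i l j).
  by set z := D i j l; lra.
apply/eqP; rewrite -subr_eq0 -[A i - A' i](mulmxK uG) -/(D i) D0 mul0mx.
exact: eqxx.
Qed.

(* [X m i j] is the covariant derivative of [F i j] in the direction [m]; the
   differential Bianchi identity is traced twice. *)
Lemma contracted_bianchi n (H : 'M[R]_n) (X : 'I_n -> 'I_n -> 'I_n -> 'M[R]_n)
    (Ri : 'M[R]_n) (be : 'rV[R]_n) : H \in unitmx -> H^T = H ->
  (forall m i j, X m i j + X i j m + X j m i = 0) ->
  (forall m i j, X m i j = - X m j i) ->
  (forall m i j, (X m i j *m invmx H)^T = - (X m i j *m invmx H)) ->
  (forall m l j, \sum_k X m k j l k = be 0 m * Ri l j) ->
  be *m H *m Ri = (\tr (Ri *m H) / 2) *: be.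
Proof.
move=> uH Hs Xcyc Xskew Xanti Xtr.
have sH a b : H a b = H b a by rewrite -[in LHS]Hs mxE.
pose Z k j m := X k j m *m invmx H.
have XZ k j m : X k j m = Z k j m *m H by rewrite /Z mulmxKV.
have Zanti k j m a b : Z k j m a b = - Z k j m b a.
  by have /matrixP/(_ b a) := Xanti k j m; rewrite -/(Z k j m) !mxE.
have trE : \tr (Ri *m H) = \sum_l \sum_j Ri l j * H l j.
  apply: eq_bigr => l _; rewrite mxE; apply: eq_bigr => j _; rewrite sH; ring.
(* Skewness in the pair with one index lowered moves the contraction to the other indices, so this
   term is minus a divergence of Ri. *)
have mid m : \sum_l \sum_j H l j * \sum_k X k j m l k = - (be *m H *m Ri) 0 m.
  transitivity (\sum_l \sum_j \sum_k \sum_p H l j * (Z k j m l p * H p k)).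
    apply: eq_bigr => l _; apply: eq_bigr => j _; rewrite big_distrr /=.
    by apply: eq_bigr => k _; rewrite XZ mxE big_distrr.
  transitivity (- \sum_p \sum_k H p k * \sum_j X k j m p j).
    rewrite exchange_big /=.
    under eq_bigr => j _ do
      (rewrite exchange_big /=; under eq_bigr => k _ do rewrite exchange_big /=).
    rewrite -sumrN; under [RHS]eq_bigr => p _.
      rewrite -sumrN; under eq_bigr => k _ do rewrite big_distrr -sumrN /=.
      rewrite exchange_big /=; over.
    rewrite [RHS]exchange_big /=; apply: eq_bigr => j _.
    rewrite [RHS]exchange_big /=; apply: eq_bigr => k _; apply: eq_bigr => p _.
    rewrite XZ mxE big_distrr -sumrN /=; apply: eq_bigr => l _.
    by rewrite Zanti (sH l j); ring.
  congr (- _); rewrite !mxE; apply: eq_bigr => p _; rewrite mxE big_distrl /=.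
  apply: eq_bigr => k _.
  by rewrite Xtr (sH p k); ring.
apply/rowP => m; rewrite [RHS]mxE.
have cyc l j : be 0 m * Ri l j + \sum_k X k j m l k - be 0 j * Ri l m = 0.
  rewrite -!Xtr -big_split -sumrB /=; apply: big1 => k _.
  have /matrixP/(_ l k) := Xcyc m k j; rewrite !mxE (Xskew j m k) !mxE.
  by move=> <-; ring.
have : \sum_l \sum_j H l j * (be 0 m * Ri l j + \sum_k X k j m l k - be 0 j * Ri l m) = 0.
  by apply: big1 => l _; apply: big1 => j _; rewrite cyc mulr0.
have E3 : (be *m H *m Ri) 0 m = \sum_l \sum_j H l j * (be 0 j * Ri l m).
  rewrite mxE; apply: eq_bigr => l _; rewrite mxE big_distrl /=.
  by apply: eq_bigr => j _; rewrite (sH l j); ring.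
have E1 : \tr (Ri *m H) * be 0 m = \sum_l \sum_j H l j * (be 0 m * Ri l j).
  rewrite trE big_distrl; apply: eq_bigr => l _; rewrite big_distrl.
  by apply: eq_bigr => j _ /=; ring.
(* The double trace reads s be - 2 Ri(be) = 0, whence the eigenvalue s/2. *)
have -> : \sum_l \sum_j H l j * (be 0 m * Ri l j + \sum_k X k j m l k - be 0 j * Ri l m) =
   \tr (Ri *m H) * be 0 m - (be *m H *m Ri) 0 m - (be *m H *m Ri) 0 m.
  rewrite E1 -[X in _ = _ + X - _]mid [X in _ = _ - X]E3 -big_split -sumrB /=.
  apply: eq_bigr => l _; rewrite -big_split -sumrB /=; apply: eq_bigr => j _.
  by rewrite mulrBr mulrDr.
by move: (_ 0 m) (\tr _) (be 0 m) => u v w; lra.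
Qed.

End CurvatureAlgebra.

(** * Curvature tensors in dimension three *)

Section DimensionThree.
Variable (R : realType).

Let o0 : 'I_3 := ord0.
Let o1 : 'I_3 := lift ord0 ord0.
Let o2 : 'I_3 := lift ord0 (lift ord0 ord0).

Let S (f : 'I_3 -> R) : R := f o0 + f o1 + f o2.

Let sum3 (f : 'I_3 -> R) : \sum_i f i = S f.
Proof. by rewrite /S !big_ord_recl big_ord0 addr0 addrA. Qed.

Let case3 (P : 'I_3 -> Prop) : P o0 -> P o1 -> P o2 -> forall i, P i.
Proof.
move=> P0 P1 P2 [[|[|[|//]]] i3].
- by rewrite (_ : Ordinal i3 = o0)//; exact: val_inj.
- by rewrite (_ : Ordinal i3 = o1)//; exact: val_inj.
- by rewrite (_ : Ordinal i3 = o2)//; exact: val_inj.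
Qed.

(** [s] is the successor modulo 3; cyclic order of the remaining rows and columns builds in the
    signs of the cofactors. *)
Let cof3 (H : 'M[R]_3) (j k : 'I_3) : R :=
  let s (i : 'I_3) : 'I_3 := if i == o0 then o1 else if i == o1 then o2 else o0 in
  H (s j) (s k) * H (s (s j)) (s (s k)) - H (s j) (s (s k)) * H (s (s j)) (s k).

Let det3 (H : 'M[R]_3) : \det H = \sum_k H o0 k * cof3 H o0 k.
Proof.
rewrite (expand_det_row _ o0); apply: eq_bigr => k _; congr (_ * _).
rewrite /cofactor (expand_det_row _ ord0) !big_ord_recl big_ord0 /cofactor !det_mx11 !mxE /=.
(* With entries indexed by natural numbers, ordinals that differ only in their form give the same
   atoms for [ring]. *)
have [h HE] : exists h : nat -> nat -> R, forall i j : 'I_3, H i j = h i j.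
  by exists (fun a b => H (inord a) (inord b)) => i j; rewrite !inord_val.
move: k; apply: case3; rewrite /cof3 /=; rewrite !HE /= /bump /=; ring.
Qed.

(* In dimension three the curvature tensor is determined by the Ricci tensor;
   here this is contracted with an eigenvector [be *m H] of the latter, whose
   eigenvalue is half the scalar curvature. *)
Lemma curvature_dim3 (H : 'M[R]_3) (L : 'I_3 -> 'I_3 -> 'M[R]_3) (be : 'rV[R]_3) (lam : R) :
  H^T = H -> \det H != 0 ->
  (forall i j, L i j = - L j i) -> (forall i j, (L i j)^T = - L i j) ->
  let b := be *m H in let Ri := ricci_of (fun i j => L i j *m H) in
  lam = \tr (Ri *m H) / 2 -> b *m Ri = lam *: be -> Ri *m b^T = lam *: be^T ->
  forall j k, \sum_i \sum_l b 0 i * b 0 l * L i j l k =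
    lam * be 0 j * be 0 k - (be *m b^T) 0 0 * Ri k j.
Proof.
move=> Hs detH Lij Llk b Ri lamE bRi Rib j k.
(* Sorting index pairs brings all components to a normal form for [ring]. *)
pose mn (a c : 'I_3) := if (a < c)%N then a else c.
pose mx (a c : 'I_3) := if (a < c)%N then c else a.
pose sg (a c : 'I_3) : R := if (a < c)%N then 1 else if (c < a)%N then - 1 else 0.
have [h HE] : exists h : 'I_3 -> 'I_3 -> R, forall a c, H a c = h (mn a c) (mx a c).
  exists H => a c; rewrite /mn /mx; case: ifP => // _.
  by rewrite -[in LHS]Hs mxE.
have [e LE] : exists e : 'I_3 -> 'I_3 -> 'I_3 -> 'I_3 -> R, forall i m a c,
    L i m a c = sg i m * sg a c * e (mn i m) (mx i m) (mn a c) (mx a c).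
  have L1 i a c : L i i a c = 0 by have /matrixP/(_ a c) := Lij i i; rewrite mxE => ?; lra.
  have L2 i m a : L i m a a = 0 by have /matrixP/(_ a a) := Llk i m; rewrite !mxE => ?; lra.
  have L3 i m a c : L i m a c = - L m i a c by rewrite [in LHS]Lij mxE.
  have L4 i m a c : L i m a c = - L i m c a.
    by have /matrixP/(_ c a) := Llk i m; rewrite !mxE.
  exists L => i m a c; rewrite /sg /mn /mx.
  case: (ltngtP i m) => [_|_|/val_inj ->]; case: (ltngtP a c) => [_|_|/val_inj ->];
    rewrite ?L1 ?L2 ?(mul0r, mulr0)//; first by ring.
  - by rewrite L4; ring.
  - by rewrite L3; ring.
  - by rewrite L3 L4; ring.
have RiE a c : Ri a c = \sum_p \sum_q L p c a q * H q p.
  by rewrite mxE; apply: eq_bigr => p _; rewrite mxE.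
(* The skew symmetries of [L] alone do not make [Ri] symmetric, so the left and right eigenvector
   equations have separate defects. *)
pose C c := 2 * \sum_a b 0 a * Ri a c - 2 * lam * be 0 c.
pose C' c := 2 * \sum_a Ri c a * b 0 a - 2 * lam * be 0 c.
have C0 c : C c = 0.
  by rewrite /C; have /matrixP/(_ 0 c) := bRi; rewrite !mxE => ->; ring.
have C'0 c : C' c = 0.
  rewrite /C'; have /matrixP/(_ c 0) := Rib; rewrite !mxE.
  under eq_bigr do rewrite [b^T _ _]mxE.
  by move=> ->; ring.
have trE : 2 * lam = \sum_a \sum_c Ri a c * H c a.
  rewrite lamE mulrC divfK ?pnatr_eq0//; apply: eq_bigr => a _.
  by rewrite mxE.
have bE a : b 0 a = \sum_c be 0 c * H c a by rewrite mxE.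
have qE : (be *m b^T) 0 0 = \sum_a be 0 a * b 0 a.
  by rewrite mxE; apply: eq_bigr => a _; rewrite [b^T _ _]mxE.
have D2 : 2 * \det H != 0 by rewrite mulf_neq0// pnatr_eq0.
apply: (mulfI D2); apply/eqP; rewrite -subr_eq0; apply/eqP.
(* Once [2 * lam] is written as a trace, the difference of the two sides, multiplied by
   [2 * \det H], is this combination of the defects as a polynomial in the entries of [H], [L] and
   [be]. *)
transitivity (\det H * (be 0 k * C j + be 0 j * C' k) - cof3 H k j * \sum_c C c * b 0 c);
  last first.
  by rewrite C0 C'0 big1 ?mulr0 ?addr0 ?mulr0 ?subr0// => c _; rewrite C0 mul0r.
transitivity (\det H * (2 * (\sum_i \sum_l b 0 i * b 0 l * L i j l k)
   - (2 * lam) * be 0 j * be 0 k + 2 * (be *m b^T) 0 0 * Ri k j)); first by ring.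
have {}bE a : b 0 a = S (fun c => be 0 c * h (mn c a) (mx c a)).
  by rewrite bE sum3 /S /= !HE.
have {}RiE a c : Ri a c = S (fun p => S (fun q =>
    sg p c * sg a q * e (mn p c) (mx p c) (mn a q) (mx a q) * h (mn q p) (mx q p))).
  by rewrite RiE sum3 /S !sum3 /S !LE !HE.
rewrite /C /C' trE qE det3 ?sum3 /S ?sum3 /S ?sum3 /S !LE !HE !bE !RiE /S /cof3 !HE.
move: j k; apply: case3; apply: case3; rewrite /mn /mx /sg /=; ring.
Qed.
End DimensionThree.

(** * Pointwise consequences of the commutation and of the eigenvector equation *)

Section PointwiseRicci.
Variables (R : realType) (n : nat) (G : 'M[R]_n) (F : 'I_n -> 'I_n -> 'M[R]_n).
Hypotheses (pG : posdef G)
  (Fanti : forall i j, (F i j *m G)^T = - (F i j *m G)).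
Let H := invmx G.
Let Ri := ricci_of F.
Let rho := Ri *m H.
Hypothesis Frho : forall i j, F i j *m rho = rho *m F i j.
Variable b : 'rV[R]_n.
Hypotheses (b0 : b != 0) (brho : b *m rho = (\tr rho / 2) *: b).

Let uG : G \in unitmx := posdef_unit pG.
Let Gs : G^T = G := pG.1.
Let Hs : H^T = H. Proof. by rewrite /H trmx_inv Gs. Qed.

Lemma quasi_einstein_dim (w : 'rV[R]_n) (a c : R) :
  (3 <= n)%N -> Ri != 0 -> w != 0 ->
  Ri = a *: G + c *: (((w *m H *m w^T) 0 0)^-1 *: (w^T *m w)) -> n = 3%N.
Proof.
move=> n3 Ri0 w0 RiE.
pose u := w *m H; set q := (w *m H *m w^T) 0 0 in RiE.
have u0 : u != 0 by apply: contra w0 => /eqP uz; rewrite -[w](mulmxKV uG) -/H -/u uz mul0mx.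
have uw : u *m w^T = q%:M by rewrite [LHS]mx11_scalar.
have q0 : q != 0.
  rewrite gt_eqF//; have := pG.2 u u0.
  by rewrite /u trmx_mul Hs !mulmxA mulmxKV.
have rhoE : rho = a%:M + (c / q) *: (w^T *m u).
  rewrite /rho RiE mulmxDl -!scalemxAl mulmxV// -/H scalemx1 scalerA.
  by rewrite -mulmxA.
have vrho (v : 'rV_n) : v *m rho = a *: v + (c / q * (v *m w^T) 0 0) *: u.
  rewrite rhoE mulmxDr mul_mx_scalar -scalemxAr mulmxA [v *m w^T]mx11_scalar.
  by rewrite mul_scalar_mx !mxE eqxx mulr1n scalerA.
have urho : u *m rho = (a + c) *: u.
  by rewrite vrho uw !mxE eqxx mulr1n divfK// -scalerDl.
have trrho : \tr rho = a * n%:R + c.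
  rewrite rhoE linearD linearZ /= mxtrace_scalar mxtrace_mulC uw mxtrace_scalar.
  by rewrite mulr1n divfK// mulr_natr.
have a0 : c = 0 -> a = 0 -> False.
  by move=> c0 az; move/eqP: Ri0; apply; rewrite RiE c0 az !scale0r addr0.
(* If [c] vanishes, then Ri = a g, and the eigenvector equation says a = n a / 2, against n >= 3. *)
have [c0|c0] := eqVneq c 0.
  have : (a - \tr rho / 2) *: b == 0.
    by rewrite scalerBl -brho vrho c0 !mul0r scale0r addr0 subrr.
  rewrite scaler_eq0 (negbTE b0) orbF trrho c0 addr0 => /eqP an.
  have /eqP : a * (2 - n%:R) = 0 by lra.
  rewrite mulf_eq0 => /orP[/eqP /(a0 c0)//|]; rewrite subr_eq0 (eqr_nat R 2) => /eqP n2.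
  by rewrite -n2 in n3.
(* Skewness makes this vector orthogonal to [u], where [rho] acts as [a]; commutation makes it an
   eigenvector for [a + c]. As [c] is nonzero, it vanishes. *)
have uF i j : u *m F i j = 0.
  have uFw : (u *m F i j *m w^T) 0 0 = 0.
    have -> : w^T = G *m u^T by rewrite /u trmx_mul Hs mulmxA mulmxV// mul1mx.
    rewrite -mulmxA (mulmxA (F i j)).
    have : (u *m (F i j *m G *m u^T))^T = - (u *m (F i j *m G *m u^T)).
      by rewrite trmx_mul (trmx_mul (F i j *m G)) trmxK Fanti mulmxN mulNmx mulmxA.
    move: (u *m _) => x /matrixP/(_ 0 0); rewrite [LHS]mxE [RHS]mxE => ?; lra.
  have : u *m F i j *m rho = (a + c) *: (u *m F i j).
    by rewrite -mulmxA Frho mulmxA urho -scalemxAl.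
  rewrite vrho uFw mulr0 scale0r addr0 scalerDl => /eqP.
  by rewrite -subr_eq0 opprD addrA subrr sub0r oppr_eq0 scaler_eq0 (negbTE c0) => /eqP.
have uRi : u *m Ri = 0.
  apply/rowP => j; rewrite [LHS]mxE [RHS]mxE.
  under eq_bigr => l _ do rewrite [Ri l j]mxE big_distrr /=.
  rewrite exchange_big /=; apply: big1 => k _.
  by have /rowP/(_ k) := uF k j; rewrite [LHS]mxE [RHS]mxE.
have ac : a + c = 0.
  apply/eqP; have : (a + c) *: u == 0 by rewrite -urho /rho mulmxA uRi mul0mx.
  by rewrite scaler_eq0 (negbTE u0) orbF.
have {}ac : c = - a by lra.
have az : a != 0 by move: c0; rewrite ac oppr_eq0.
have n1 : a * (n%:R - 1) != 0.
  rewrite mulf_neq0// subr_eq0 (eqr_nat R _ 1).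
  by apply: contraTneq n3 => ->.
have bE : (a * (n%:R - 1) / 2) *: b = a *: b + (c / q * (b *m w^T) 0 0) *: u.
  by rewrite -vrho brho trrho ac; congr (_ *: _); ring.
(* [u] has eigenvalue 0 and [b] the nonzero eigenvalue (n - 1) a / 2, so they are orthogonal; hence
   [b] also has eigenvalue [a]. *)
have bw : (b *m w^T) 0 0 = 0.
  have /matrixP/(_ 0 0) : ((a * (n%:R - 1) / 2) *: b) *m w^T =
      a *: (b *m w^T) + (c / q * (b *m w^T) 0 0) *: (u *m w^T).
    by rewrite bE mulmxDl -!scalemxAl.
  rewrite -scalemxAl uw; move: (b *m w^T) => z; rewrite !mxE eqxx mulr1n.
  have -> : c / q * z 0 0 * q = c * z 0 0 by field.
  rewrite ac => zE.
  apply: (mulfI n1); rewrite mulr0.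
  lra.
move: bE; rewrite bw mulr0 scale0r addr0 => /eqP; rewrite -subr_eq0 -scalerBl.
rewrite scaler_eq0 (negbTE b0) orbF => /eqP E.
have /eqP : a * (n%:R - 3) = 0 by lra.
by rewrite mulf_eq0 (negbTE az) subr_eq0 (eqr_nat R _ 3) => /eqP.
Qed.
End PointwiseRicci.

(** [S] is the curvature contracted twice with [b]. As the curvature operators commute with [rho]
    and [b] is an eigenvector, S rho = lam S with lam = s/2. The term of [S] in [be^T *m b]
    satisfies the same equation, hence so does the other term, a nonzero multiple of [rho]. The
    dimension is kept as an equation because that of the manifold is a variable. *)
Lemma ricci_dim3 (R : realType) n (G : 'M[R]_n) (F : 'I_n -> 'I_n -> 'M[R]_n) (b : 'rV[R]_n) :
  n = 3%N -> posdef G -> (forall i j, F i j = - F j i) ->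
  (forall i j, (F i j *m G)^T = - (F i j *m G)) ->
  let Ri := ricci_of F in let rho := Ri *m invmx G in
  Ri^T = Ri -> (forall i j, F i j *m rho = rho *m F i j) ->
  b != 0 -> b *m rho = (\tr rho / 2) *: b ->
  rho *m rho = (\tr rho / 2) *: rho.
Proof.
move=> n3; subst n => pG Fskew Fanti Ri rho Ris Frho b0 brho.
have uG := posdef_unit pG; have Gs := pG.1.
set H := invmx G; have Hs : H^T = H by rewrite /H trmx_inv Gs.
set lam := \tr rho / 2 in brho *.
pose be := b *m G; have beH : be *m H = b by rewrite /be mulmxK.
have FH : ricci_of (fun i j => F i j *m G *m H) = Ri.
  by apply/matrixP => l j; rewrite !mxE; apply: eq_bigr => k _; rewrite mulmxK.
have bRi : b *m Ri = lam *: be.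
  by rewrite /be scalemxAl -brho /rho mulmxA mulmxKV.
have Rib : Ri *m b^T = lam *: be^T by rewrite -[in LHS]Ris -trmx_mul bRi linearZ.
pose q := (be *m b^T) 0 0.
have q0 : q != 0 by rewrite gt_eqF//; exact: pG.2.
have SE := @curvature_dim3 _ H (fun i j => F i j *m G) be lam Hs.
have {}SE : forall j k, \sum_i \sum_l b 0 i * b 0 l * (F i j *m G) l k =
    lam * be 0 j * be 0 k - q * Ri k j.
  move=> j k; move: SE; rewrite /= beH FH; apply => //.
  - by rewrite -unitfE -unitmxE unitmx_inv.
  - by move=> i m; rewrite [in LHS]Fskew mulNmx.
pose S : 'M[R]_3 := \matrix_j (\sum_i b 0 i *: (b *m F i j)).
have SG : S *m G = lam *: (be^T *m be) - q *: Ri.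
  apply/matrixP => j k.
  have -> : (lam *: (be^T *m be) - q *: Ri) j k = lam * be 0 j * be 0 k - q * Ri k j.
    have : Ri j k = Ri k j by rewrite -[in LHS]Ris mxE.
    move: (Ri) (be) => Z be' ZC.
    by rewrite !mxE big_ord1 !mxE mulrA ZC.
  rewrite -SE; transitivity (row j (S *m G) 0 k); first by rewrite [RHS]mxE.
  rewrite row_mul rowK mulmx_suml summxE; apply: eq_bigr => i _.
  rewrite -scalemxAl -mulmxA 2!mxE big_distrr /=; apply: eq_bigr => l _.
  by rewrite mulrA.
have SE' : S = lam *: (be^T *m b) - q *: rho.
  by rewrite -[LHS](mulmxK uG) SG mulmxBl -!scalemxAl -mulmxA -/H beH.
have Srho : S *m rho = lam *: S.
  apply/row_matrixP => j; rewrite row_mul linearZ /= rowK mulmx_suml scaler_sumr.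
  apply: eq_bigr => i _; rewrite -scalemxAl -mulmxA Frho mulmxA brho -scalemxAl.
  by rewrite !scalerA mulrC.
apply: (scalerI q0); move: Srho.
rewrite SE' mulmxBl -!scalemxAl -mulmxA brho -scalemxAr scalerBr => /addrI/oppr_inj ->.
by rewrite !scalerA mulrC.
Qed.

(** * The curvature in a chart *)

Section ChartGeometry.
Variables (R : realType) (n : nat) (M : manifold R n) (g : metric M) (c : chart M).
Local Notation vec := 'rV[R]_n.
Local Notation U := (coord c @` dom c).
Local Notation G := (g c).

Lemma chart_open : open U. Proof. exact: coord_open. Qed.
Let oU := chart_open.

Lemma metric_msmooth : msmooth U G.
Proof. exact/(smooth_mxP _ oU)/gij_smooth. Qed.
Let sG := metric_msmooth.

Lemma metric_posdef x : U x -> posdef (G x).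
Proof. by move=> [p cp <-]; split; [exact: gij_sym|move=> v; exact: gij_pos]. Qed.

Lemma metric_unit x : U x -> G x \in unitmx.
Proof. by move=> /metric_posdef/posdef_unit. Qed.

Lemma metric_sym x : U x -> (G x)^T = G x.
Proof. by move=> /metric_posdef[]. Qed.

Lemma inv_metric_sym x : U x -> (invmx (G x))^T = invmx (G x).
Proof. by move=> Ux; rewrite trmx_inv metric_sym. Qed.

Lemma inv_metric_msmooth : msmooth U (fun x => invmx (G x)).
Proof. by apply: msmoothV => // x; exact: metric_unit. Qed.

(* Row [j], column [k] holds Gamma^k_ij. *)
Definition conn (i : 'I_n) (x : vec) : 'M[R]_n :=
  \matrix_(j, k) christoffel g c x k i j.

(** Christoffel symbols of the first kind: the upper index of [conn], lowered. *)
Let K (i : 'I_n) (x : vec) : 'M[R]_n := \matrix_(j, l)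
  (2^-1 * (dmx i G x j l + dmx j G x i l - dmx l G x i j)).

Lemma dmetric_sym i x : U x -> (dmx i G x)^T = dmx i G x.
Proof.
by move=> Ux; rewrite -dmxT; apply: dmx_ext oU _ Ux => y; exact: metric_sym.
Qed.

Let connE i x : U x -> conn i x = K i x *m invmx (G x).
Proof.
move=> Ux; apply/matrixP => j k; rewrite !mxE /christoffel big_distrr /=.
apply: eq_bigr => l _; rewrite mxE /dmetric /inv_metric.
rewrite !partial_mx; try exact: smooth_diff (gij_smooth g c) Ux.
have -> : invmx (G x) l k = invmx (G x) k l by rewrite -[in LHS]inv_metric_sym// mxE.
by move: (invmx _ _ _) => h; ring.
Qed.

Lemma conn_msmooth i : msmooth U (conn i).
Proof.
have sK : msmooth U (K i).
  move=> j l.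
  have sd a b d : smooth U (fun x => dmx a G x b d : R^o) by exact: (msmooth_dmx a oU sG b d).
  have h := smoothM oU (smooth_cst (2^-1 : R^o) oU)
    (smoothD oU (smoothD oU (sd i j l) (sd j i l))
      (smoothM oU (smooth_cst (-1 : R^o) oU) (sd l i j))).
  by apply: smooth_ext h => // x _ /=; rewrite mxE mulN1r.
by apply: msmooth_ext (msmoothM oU sK inv_metric_msmooth) => // x Ux; rewrite connE.
Qed.
Let sA := conn_msmooth.

Lemma conn_sym i j k x : U x -> conn i x j k = conn j x i k.
Proof.
move=> Ux; rewrite !connE// !mxE; apply: eq_bigr => l _; rewrite !mxE; congr (_ * _).
have -> : dmx l G x j i = dmx l G x i j by rewrite -[in LHS]dmetric_sym// mxE.
by ring.
Qed.

Lemma conn_metric i x : U x ->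
  dmx i G x = conn i x *m G x + G x *m (conn i x)^T.
Proof.
move=> Ux; rewrite -[in G x *m _](metric_sym Ux) -trmx_mul connE// mulmxKV ?metric_unit//.
apply/matrixP => j l; rewrite !mxE.
have -> : dmx i G x l j = dmx i G x j l by rewrite -[in LHS]dmetric_sym// mxE.
by move: (dmx _ _ _ _ _) (dmx _ _ _ _ _) (dmx _ _ _ _ _) => p q r; lra.
Qed.

(** The commutator has the opposite sign to the usual one because the matrices act on row
    vectors. *)
Definition curv (i j : 'I_n) (x : vec) : 'M[R]_n :=
  dmx i (conn j) x - dmx j (conn i) x + conn j x *m conn i x - conn i x *m conn j x.

Lemma riemannE k l i j x : riemann g c x k l i j = curv i j x l k.
Proof.
rewrite /riemann /curv !mx_linE !dmxE /dchristoffel.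
rewrite -[RHS]addrA; congr (_ - _ + _).
- by apply: eq_partial => y; rewrite mxE.
- by apply: eq_partial => y; rewrite mxE.
rewrite !mxE -sumrB; apply: eq_bigr => m _; rewrite !mxE.
by congr (_ - _); exact: mulrC.
Qed.

Lemma ricciE x : ricci g c x = ricci_of (fun i j => curv i j x).
Proof.
by apply/matrixP => i j; rewrite !mxE; apply: eq_bigr => k _; rewrite riemannE.
Qed.

Lemma curv_msmooth i j : msmooth U (curv i j).
Proof.
have sd a b : msmooth U (dmx a (conn b)) by exact: msmooth_dmx.
have sm a b : msmooth U (fun x => conn a x *m conn b x) by exact: msmoothM.
exact: (msmoothB oU (msmoothD oU (msmoothB oU (sd i j) (sd j i)) (sm j i)) (sm i j)).
Qed.

Lemma ricci_msmooth : msmooth U (ricci g c).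
Proof.
move=> i j; have := @smooth_sum _ _ U 'I_n (index_enum _) xpredT
  (fun k x => curv k j x i k : R^o) oU (fun k => curv_msmooth k j i k).
by apply: smooth_ext => // x _; rewrite ricciE mxE.
Qed.

Lemma cov_derivE (T : chart M -> vec -> 'M[R]_n) i j l x :
  cov_deriv g T c x i j l =
  (dmx l (T c) x - conn l x *m T c x - T c x *m (conn l x)^T) i j.
Proof.
rewrite /cov_deriv !mx_linE dmxE -addrA -opprD; congr (_ - _).
rewrite !mxE -big_split /=; apply: eq_bigr => m _; rewrite !mxE.
by congr (_ + _); exact: mulrC.
Qed.

Lemma curv_skew i j x : curv i j x = - curv j i x.
Proof. by rewrite /curv; mx_noncomm. Qed.

(** Metric compatibility, differentiated once more, expresses the second derivatives of the metric;
    their symmetry is the claim. *)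
Lemma curv_metric_skew i j x : U x -> (curv i j x *m G x)^T = - (curv i j x *m G x).
Proof.
move=> Ux.
have D a b : dmx a (dmx b G) x =
    dmx a (conn b) x *m G x + conn b x *m dmx a G x
    + (dmx a G x *m (conn b x)^T + G x *m (dmx a (conn b) x)^T).
  rewrite (dmx_ext a oU (conn_metric b) Ux).
  have s1 : msmooth U (fun y => conn b y *m G y) by exact: msmoothM.
  have sT : msmooth U (fun y => (conn b y)^T) by exact: msmoothT.
  have s2 : msmooth U (fun y => G y *m (conn b y)^T) by exact: msmoothM.
  rewrite (dmxD Ux a s1 s2) (dmxM Ux a (sA b) sG) (dmxM Ux a sG sT) dmxT.
  by [].
have := dmxC Ux i j oU sG; rewrite !D !conn_metric//.
rewrite trmx_mul metric_sym// /curv.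
move: (G x) (conn i x) (conn j x) (dmx i (conn j) x) (dmx j (conn i) x) => g0 Ai Aj dij dji E.
rewrite !trmx_addE !trmx_mul.
apply/eqP; rewrite -addr_eq0; apply/eqP.
rewrite -[RHS](subrr (dij *m g0 + Aj *m (Ai *m g0 + g0 *m Ai^T)
      + ((Ai *m g0 + g0 *m Ai^T) *m Aj^T + g0 *m dij^T))) [X in _ = _ - X]E.
by mx_noncomm.
Qed.

(** First Bianchi identity: the symmetry of the Christoffel symbols cancels the terms in pairs. *)
Lemma curv_cyclic i j l k x : U x ->
  curv i j x l k + curv j l x i k + curv l i x j k = 0.
Proof.
move=> Ux.
have dsym a b d : dmx a (conn b) x d k = dmx a (conn d) x b k.
  rewrite !dmxE; apply: partial_near_eq; apply: near_open oU _ _ Ux => y Uy.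
  exact: conn_sym.
have msym a b d : (conn a x *m conn b x) d k = (conn d x *m conn b x) a k.
  by rewrite !mxE; apply: eq_bigr => m _; rewrite conn_sym.
rewrite /curv !mx_linE (dsym i j l) (dsym j l i) (dsym l i j).
rewrite (msym j i l) (msym l j i) (msym i l j).
by ring.
Qed.

(** The trace pairs a skew form with the symmetric inverse metric. *)
Lemma curv_tr0 i j x : U x -> \tr (curv i j x) = 0.
Proof.
move=> Ux; have uG := metric_unit Ux.
have E : \tr (curv i j x) = - \tr (curv i j x).
  rewrite -{1}[curv i j x](mulmxK uG) -mxtrace_tr trmx_mul curv_metric_skew//.
  by rewrite inv_metric_sym// mulmxN linearN /= mxtrace_mulC mulmxK.
by move: E; lra.
Qed.

(** Contracting the first Bianchi identity leaves the trace of a curvature operator as the skew part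
    of Ri. *)
Lemma ricci_sym x : U x -> (ricci g c x)^T = ricci g c x.
Proof.
move=> Ux; rewrite ricciE; apply/matrixP => j l; rewrite !mxE.
apply/eqP; rewrite -subr_eq0 -sumrB; apply/eqP.
transitivity (- \tr (curv j l x)); last by rewrite curv_tr0// oppr0.
rewrite -[RHS]sumrN; apply: eq_bigr => k _.
have E : curv l k x j k = - curv k l x j k by rewrite curv_skew [LHS]mxE.
by have := curv_cyclic k j l k Ux; rewrite E => ?; lra.
Qed.

(* R^k_lij;m, with rows and columns as in [curv]. *)
Definition dcurv (m i j : 'I_n) (x : vec) : 'M[R]_n :=
  dmx m (curv i j) x - conn m x *m curv i j x + curv i j x *m conn m x
  - \sum_a (conn m x i a *: curv a j x) - \sum_a (conn m x j a *: curv i a x).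

Lemma dmx_curv m i j x : U x -> dmx m (curv i j) x =
  dmx m (dmx i (conn j)) x - dmx m (dmx j (conn i)) x
  + (dmx m (conn j) x *m conn i x + conn j x *m dmx m (conn i) x)
  - (dmx m (conn i) x *m conn j x + conn i x *m dmx m (conn j) x).
Proof.
move=> Ux.
have sd a b : msmooth U (dmx a (conn b)) by exact: msmooth_dmx.
have sm a b : msmooth U (fun x => conn a x *m conn b x) by exact: msmoothM.
have s1 := msmoothB oU (sd i j) (sd j i).
have s2 := msmoothD oU s1 (sm j i).
rewrite (dmxD Ux m s2 (msmoothN oU (sm i j))) (dmxD Ux m s1 (sm j i)).
rewrite (dmxD Ux m (sd i j) (msmoothN oU (sd j i))) (dmxN Ux m (sd j i)) (dmxN Ux m (sm i j)).
by rewrite (dmxM Ux m (sA j) (sA i)) (dmxM Ux m (sA i) (sA j)).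
Qed.

Lemma dcurv_skew m i j x : U x -> dcurv m i j x = - dcurv m j i x.
Proof.
move=> Ux; rewrite /dcurv !dmx_curv//.
have E (f : 'I_n -> R) k : \sum_a f a *: curv a k x = - \sum_a f a *: curv k a x.
  by rewrite -sumrN; apply: eq_bigr => a _; rewrite curv_skew scalerN.
rewrite (E (conn m x i) j) (E (conn m x j) i) (curv_skew i j).
by mx_noncomm.
Qed.

(** Second Bianchi identity. The corrections for the indices of the pair cancel, the connection
    being symmetric and the curvature skew; the rest follows from the symmetry of second derivatives
    and the Jacobi identity. *)
Lemma dcurv_cyclic m i j x : U x ->
  dcurv m i j x + dcurv i j m x + dcurv j m i x = 0.
Proof.
move=> Ux; rewrite /dcurv.
have [S SE] : exists S : 'I_n -> 'I_n -> 'I_n -> 'M[R]_n,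
    forall a b k, \sum_e conn a x b e *: curv k e x = S a b k by eexists.
have E a b k : \sum_e conn a x b e *: curv e k x = - S b a k.
  rewrite -SE -sumrN; apply: eq_bigr => e _.
  by rewrite curv_skew scalerN conn_sym.
rewrite (E m i j) (E i j m) (E j m i) !SE !dmx_curv// /curv.
rewrite (dmxC Ux m i oU (sA j)) (dmxC Ux m j oU (sA i)) (dmxC Ux i j oU (sA m)).
by mx_noncomm.
Qed.

(** The skewness of [curv i j *m G] is differentiated; by metric compatibility the derivative of [G]
    contributes only connection terms. *)
Lemma dcurv_metric_skew m i j x : U x ->
  (dcurv m i j x *m G x)^T = - (dcurv m i j x *m G x).
Proof.
move=> Ux.
have sum_skew (f : 'I_n -> R) (h : 'I_n -> 'M[R]_n) : (forall a, (h a *m G x)^T = - (h a *m G x)) ->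
    ((\sum_a f a *: h a) *m G x)^T = - ((\sum_a f a *: h a) *m G x).
  move=> hs; rewrite mulmx_suml linear_sum -sumrN /=; apply: eq_bigr => a _.
  by rewrite -scalemxAl linearZ /= hs scalerN.
have E1 := sum_skew (conn m x i) _ (fun a => curv_metric_skew a j Ux).
have E2 := sum_skew (conn m x j) _ (fun a => curv_metric_skew i a Ux).
have D : (dmx m (curv i j) x *m G x + curv i j x *m dmx m G x)^T =
    - (dmx m (curv i j) x *m G x + curv i j x *m dmx m G x).
  have sFG := msmoothM oU (curv_msmooth i j) sG.
  rewrite -(dmxM Ux m (curv_msmooth i j) sG) -dmxT -(dmxN Ux m sFG).
  by apply: dmx_ext oU _ Ux => y; exact: curv_metric_skew.
move: D; rewrite conn_metric// /dcurv.
have := curv_metric_skew i j Ux.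
move: E1 E2 (metric_sym Ux); move: (dmx m _ x) (curv i j x) (conn m x) (G x) => f F0 A0 g0.
move: (\sum_a _) (\sum_a _) => S1 S2 E1 E2 gs.
rewrite trmx_mul gs => F0s D.
have fE : g0 *m f^T = - (f *m g0) - F0 *m A0 *m g0 - F0 *m g0 *m A0^T
    - g0 *m A0^T *m F0^T + A0 *m F0 *m g0.
  apply/matrixP => a b; move/matrixP/(_ a b): D.
  rewrite !trmx_addE !trmx_mul trmx_addE !trmx_mul trmxK gs.
  rewrite !(mulmxDl, mulmxDr) -(mulmxA A0 g0) F0s !mulmxN !mulmxA !mx_linE => ?; lra.
rewrite !mulmxBl mulmxDl mulmxBl !trmx_addE E1 E2 !trmx_mul gs.
rewrite !mulmxA F0s fE.
by mx_noncomm.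
Qed.

End ChartGeometry.

(** * Consequences of the recurrence in a chart *)

Section RicciTensor.
Variables (R : realType) (n : nat) (M : manifold R n) (g : metric M).

(* The Ricci operator: row index lowered, column index raised. *)
Definition ricci_op (c : chart M) (x : 'rV[R]_n) : 'M[R]_n :=
  ricci g c x *m invmx (g c x).

Definition scal c x : R := \tr (ricci_op c x).

(** This is |Ri|^2, as the Ricci operator is self-adjoint. *)
Definition ricci_sqr c x : R := \tr (ricci_op c x *m ricci_op c x).

(* Vanishes exactly when the eigenvalues of the Ricci operator are 0 and half
   the scalar curvature. *)
Definition defect_op c x : 'M[R]_n :=
  ricci_op c x *m ricci_op c x - (scal c x / 2) *: ricci_op c x.

(** The squared norm of the self-adjoint [defect_op], a scalar whose zeros can be propagated. *)
Definition defect c x : R := \tr (defect_op c x *m defect_op c x).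

Variable c : chart M.
Local Notation vec := 'rV[R]_n.
Local Notation U := (coord c @` dom c).
Local Notation G := (g c).
Local Notation Ri := (ricci g c).
Local Notation rho := (ricci_op c).

Let oU : open U := @chart_open _ _ M c.
Let sG : msmooth U G := metric_msmooth g c.
Let sRi : msmooth U Ri := ricci_msmooth g c.
Let sA i : msmooth U (conn g c i) := conn_msmooth g c i.

Lemma ricci_op_msmooth : msmooth U rho.
Proof. by apply: msmoothM => //; exact: inv_metric_msmooth. Qed.
Let srho := ricci_op_msmooth.

Lemma scal_smooth : smooth U (scal c : vec -> R^o).
Proof. exact: smooth_tr. Qed.

Lemma ricci_op_metric x : U x -> rho x *m G x = Ri x.
Proof. by move=> Ux; rewrite /ricci_op mulmxKV// metric_unit. Qed.

Lemma ricci_sqr_eq0 x : U x -> ricci_sqr c x = 0 -> Ri x = 0.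
Proof.
move=> Ux s0; have -> : Ri x = rho x *m G x by rewrite ricci_op_metric.
rewrite (mxtrace_sqr_eq0 (metric_posdef g Ux) _ s0) ?mul0mx//.
by rewrite ricci_op_metric// ricci_sym.
Qed.

Lemma defect_eq0 x : U x -> defect c x = 0 -> rho x *m rho x = (scal c x / 2) *: rho x.
Proof.
move=> Ux d0; apply/eqP; rewrite -subr_eq0; apply/eqP.
apply: (mxtrace_sqr_eq0 (metric_posdef g Ux) _ d0).
rewrite mulmxBl -scalemxAl -mulmxA ricci_op_metric// !trmx_addE.
have -> : ((scal c x / 2) *: Ri x)^T = (scal c x / 2) *: Ri x.
  by rewrite linearZ /= ricci_sym.
congr (_ - _); rewrite trmx_mul ricci_sym// -[in LHS](ricci_op_metric Ux).
rewrite -[in RHS](ricci_op_metric Ux).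
have rG : G x *m (rho x)^T = rho x *m G x.
  by rewrite -[in LHS](metric_sym g Ux) -trmx_mul ricci_op_metric// ricci_sym.
by rewrite -(mulmxA _ (G x)) rG.
Qed.

Lemma dcurv_trace m l j x : U x -> \sum_k dcurv g c m k j x l k =
  (dmx m Ri x - conn g c m x *m Ri x - Ri x *m (conn g c m x)^T) l j.
Proof.
move=> Ux; rewrite 4!mx_linE dmxE.
have -> : partial m (fun y => Ri y l j : R^o) x = \sum_k dmx m (curv g c k j) x l k.
  under [RHS]eq_bigr do rewrite dmxE.
  rewrite -partial_sum => [|k]; last exact: msmooth_entry_diff (curv_msmooth g c k j) Ux.
  by apply: eq_partial => y; rewrite ricciE mxE.
have -> : (conn g c m x *m Ri x) l j = \sum_k (conn g c m x *m curv g c k j x) l k.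
  under [RHS]eq_bigr do rewrite mxE.
  rewrite exchange_big mxE; apply: eq_bigr => a _.
  by rewrite ricciE [ricci_of _ _ _]mxE big_distrr.
have -> : (Ri x *m (conn g c m x)^T) l j = \sum_k (\sum_a conn g c m x j a *: curv g c k a x) l k.
  under [RHS]eq_bigr do rewrite summxE.
  rewrite exchange_big mxE; apply: eq_bigr => a _.
  rewrite ricciE [ricci_of _ _ _]mxE big_distrl; apply: eq_bigr => k _.
  by rewrite [_^T _ _]mxE [RHS]mxE mulrC.
(* The connection terms of the two contracted indices cancel, so contraction commutes with covariant
   differentiation. *)
have E : \sum_k (curv g c k j x *m conn g c m x) l k =
    \sum_k (\sum_a conn g c m x k a *: curv g c a j x) l k.
  under [RHS]eq_bigr do rewrite summxE.
  under [LHS]eq_bigr do rewrite mxE.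
  rewrite exchange_big; apply: eq_bigr => a _; apply: eq_bigr => k _.
  by rewrite [RHS]mxE mulrC.
rewrite -!sumrB -[LHS](subrK (\sum_k (curv g c k j x *m conn g c m x) l k)).
rewrite {2}E -sumrB -big_split /=; apply: eq_bigr => k _.
by rewrite /dcurv !mx_linE; ring.
Qed.

Section Recurrence.
Variable be : vec -> vec.
Hypothesis sbe : forall l, smooth U (fun x => be x 0 l : R^o).
Hypothesis rec : forall l x, U x ->
  dmx l Ri x = be x 0 l *: Ri x + conn g c l x *m Ri x + Ri x *m (conn g c l x)^T.

Lemma recurrence_eigenvector x : U x -> let b := be x *m invmx (G x) in
  b *m rho x = (scal c x / 2) *: b.
Proof.
move=> Ux /=; rewrite /ricci_op mulmxA.
have -> : be x *m invmx (G x) *m Ri x = (scal c x / 2) *: be x; last by rewrite -scalemxAl.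
apply: (@contracted_bianchi _ _ _ (fun m i j => dcurv g c m i j x)).
- by rewrite unitmx_inv metric_unit.
- exact: inv_metric_sym.
- by move=> m i j; exact: dcurv_cyclic.
- by move=> m i j; exact: dcurv_skew.
- by move=> m i j; rewrite invmxK; exact: dcurv_metric_skew.
- move=> m l j; rewrite dcurv_trace// rec//.
  by rewrite !mx_linE; ring.
Qed.

(* The covariant derivative of the field of endomorphisms [P] is [k be (x) P]. *)
Definition recurrent_op (k : R) (P : vec -> 'M[R]_n) : Prop :=
  msmooth U P /\ forall l x, U x -> dmx l P x =
    (k * be x 0 l) *: P x + conn g c l x *m P x - P x *m conn g c l x.

(** The metric is parallel, so an index can be raised under the covariant derivative. *)
Lemma recurrent_ricci_op : recurrent_op 1 rho.
Proof.
split=> // l x Ux.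
have E : dmx l rho x *m G x + rho x *m dmx l G x = dmx l Ri x.
  rewrite -(dmxM Ux l srho sG); apply: dmx_ext oU _ Ux => y; exact: ricci_op_metric.
apply: (row_free_inj (A := G x)); first by rewrite row_free_unit metric_unit.
move: E; rewrite rec// conn_metric// -(ricci_op_metric Ux) => E.
rewrite -[LHS](addrK (rho x *m (conn g c l x *m G x + G x *m (conn g c l x)^T))) E.
by mx_noncomm.
Qed.

Lemma recurrent_opM k m P Q : recurrent_op k P -> recurrent_op m Q ->
  recurrent_op (k + m) (fun x => P x *m Q x).
Proof.
move=> [sP dP] [sQ dQ]; split; first exact: msmoothM.
by move=> l x Ux; rewrite (dmxM Ux l sP sQ) dP// dQ//; mx_noncomm.
Qed.

Lemma recurrent_opB k P Q : recurrent_op k P -> recurrent_op k Q ->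
  recurrent_op k (fun x => P x - Q x).
Proof.
move=> [sP dP] [sQ dQ]; split; first exact: msmoothB.
move=> l x Ux; rewrite (dmxD Ux l sP (msmoothN oU sQ)) (dmxN Ux l sQ) dP// dQ//.
by mx_noncomm.
Qed.

(** The connection enters through a commutator, whose trace is zero. *)
Lemma recurrent_tr k P : recurrent_op k P -> forall l x, U x ->
  partial l (fun y => \tr (P y) : R^o) x = (k * be x 0 l) * \tr (P x).
Proof.
move=> [sP dP] l x Ux; rewrite (partial_tr Ux l sP) dP//.
by rewrite !linearD linearN linearZ /= (mxtrace_mulC (P x)) addrK.
Qed.

Lemma recurrent_opZ k m (s : vec -> R^o) P : smooth U s ->
  (forall l x, U x -> partial l s x = (k * be x 0 l) * s x) ->
  recurrent_op m P -> recurrent_op (k + m) (fun x => s x *: P x).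
Proof.
move=> ss ds [sP dP]; split; first exact: msmoothZ.
move=> l x Ux; rewrite (dmxZ Ux l ss sP) ds// dP//.
rewrite !scalerDr !scalerN -!scalemxAl -!scalemxAr !scalerA addrA addrA -scalerDl.
by congr (_ *: _ + _ - _); ring.
Qed.

Lemma partial_scal l x : U x -> partial l (scal c : vec -> R^o) x = be x 0 l * scal c x.
Proof.
by move=> Ux; rewrite (recurrent_tr recurrent_ricci_op)// mul1r.
Qed.

Lemma partial_ricci_sqr l x : U x ->
  partial l (ricci_sqr c : vec -> R^o) x = (2 * be x 0 l) * ricci_sqr c x.
Proof.
move=> Ux; rewrite (recurrent_tr (recurrent_opM recurrent_ricci_op recurrent_ricci_op))//.
Qed.

Lemma partial_defect l x : U x ->
  partial l (defect c : vec -> R^o) x = (4 * be x 0 l) * defect c x.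
Proof.
move=> Ux.
have s1 : smooth U (fun y => scal c y / 2 : R^o).
  exact: (smoothM oU scal_smooth (smooth_cst (2^-1 : R^o) oU)).
have rs : recurrent_op (1 + 1) (fun y => (scal c y / 2) *: rho y).
  apply: recurrent_opZ s1 _ recurrent_ricci_op => m y Uy.
  rewrite (partialM m (smooth_diff scal_smooth Uy) (differentiable_cst _ _)).
  by rewrite partial_cst mulr0 add0r partial_scal// mul1r mulrC mulrA.
have rd := recurrent_opB (recurrent_opM recurrent_ricci_op recurrent_ricci_op) rs.
by rewrite (recurrent_tr (recurrent_opM rd rd))//; congr (_ * _ * _); ring.
Qed.

Lemma ricci_sqr_smooth : smooth U (ricci_sqr c : vec -> R^o).
Proof. exact: smooth_tr (msmoothM oU srho srho). Qed.

Lemma defect_smooth : smooth U (defect c : vec -> R^o).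
Proof.
have s1 : smooth U (fun y => scal c y / 2 : R^o).
  exact: (smoothM oU scal_smooth (smooth_cst (2^-1 : R^o) oU)).
have sd : msmooth U (defect_op c).
  exact: (msmoothB oU (msmoothM oU srho srho) (msmoothZ oU s1 srho)).
exact: smooth_tr (msmoothM oU sd sd).
Qed.

(* [be] is half the logarithmic differential of |Ri|^2. *)
Lemma recurrence_form_closed k l x : U x -> ricci_sqr c x != 0 ->
  partial k (fun y => be y 0 l : R^o) x = partial l (fun y => be y 0 k : R^o) x.
Proof.
move=> Ux s0.
have D a b : partial a (partial b (ricci_sqr c : vec -> R^o)) x =
    2 * ricci_sqr c x * (partial a (fun y => be y 0 b : R^o) x + 2 * be x 0 a * be x 0 b).
  have -> : partial a (partial b (ricci_sqr c : vec -> R^o)) x =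
      partial a (fun y => (2 * be y 0 b) * ricci_sqr c y : R^o) x.
    apply: partial_near_eq; apply: near_open oU _ _ Ux => y Uy.
    exact: partial_ricci_sqr.
  have db := smooth_diff (sbe b) Ux.
  have d2 : differentiable (fun y => 2 * be y 0 b : R^o) x.
    exact: (smooth_diff (smoothM oU (smooth_cst (2 : R^o) oU) (sbe b)) Ux).
  rewrite (partialM a d2 (smooth_diff ricci_sqr_smooth Ux)) partial_ricci_sqr//.
  rewrite (partialM a (differentiable_cst _ _) db) partial_cst.
  move: (partial _ _ _) (be x 0 a) (be x 0 b) (ricci_sqr c x) => z u v w.
  change (((2 : R) * v) * (2 * u * w) + w * (2 * z + v * 0) = 2 * w * (z + 2 * u * v)).
  by ring.
have := partialC k l oU ricci_sqr_smooth Ux; rewrite !D => E.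
have {E} := mulfI (mulf_neq0 (_ : 2 != 0 :> R) s0) E; rewrite ?pnatr_eq0// => /(_ isT).
move: (partial _ _ _) (partial _ _ _) => u v; lra.
Qed.

(* Ricci identity: since [be] is closed, the second covariant derivatives of
   [rho] are symmetric. *)
Lemma curv_ricci_op_comm k l x : U x -> ricci_sqr c x != 0 ->
  curv g c k l x *m rho x = rho x *m curv g c k l x.
Proof.
move=> Ux s0; have [_ drho] := recurrent_ricci_op.
have D a b : dmx a (dmx b rho) x =
    partial a (fun y => be y 0 b : R^o) x *: rho x + be x 0 b *: dmx a rho x
    + (dmx a (conn g c b) x *m rho x + conn g c b x *m dmx a rho x)
    - (dmx a rho x *m conn g c b x + rho x *m dmx a (conn g c b) x).
  have E y : U y -> dmx b rho y =
      be y 0 b *: rho y + conn g c b y *m rho y - rho y *m conn g c b y.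
    by move=> Uy; rewrite drho// mul1r.
  rewrite (dmx_ext a oU E Ux).
  have s1 := msmoothZ oU (sbe b) srho.
  have s2 := msmoothM oU (sA b) srho.
  have s3 := msmoothM oU srho (sA b).
  rewrite (dmxD Ux a (msmoothD oU s1 s2) (msmoothN oU s3)) (dmxD Ux a s1 s2) (dmxN Ux a s3).
  by rewrite (dmxZ Ux a (sbe b) srho) (dmxM Ux a (sA b) srho) (dmxM Ux a srho (sA b)).
have := dmxC Ux k l oU srho; rewrite !D (recurrence_form_closed k l Ux s0).
rewrite !drho// !mul1r /curv.
move: (conn g c k x) (conn g c l x) (dmx k (conn g c l) x) (dmx l (conn g c k) x) (rho x).
move: (partial _ _ _) => w Ak Al dkl dlk r /eqP.
rewrite -subr_eq0 => /eqP E; apply/eqP; rewrite -subr_eq0; apply/eqP.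
by rewrite -[RHS]E; mx_noncomm.
Qed.

End Recurrence.
End RicciTensor.

(** * Change of charts *)

Section ChartChange.
Variables (R : realType) (n : nat) (M : manifold R n).
Local Notation vec := 'rV[R]_n.
Implicit Types (c d e : chart M) (p : M).

Lemma chart_image_open c (O : set M) : open O -> open (coord c @` (dom c `&` O)).
Proof.
move=> oO; rewrite openE => x [p [cp Op] <-].
have Ux : (coord c @` dom c) (coord c p) by exists p.
have nU := open_nbhs_nbhs (conj (@coord_open _ _ M c) Ux).
have nO : nbhs (param c (coord c p)) O by rewrite coordK//; exact: open_nbhs_nbhs.
apply: (filterS2 _ _ nU (param_cont Ux nO)) => y [q cq <-] /=.
by rewrite coordK// => Oq; exists q.
Qed.

Lemma transition_coord c d p : dom c p -> transition c d (coord c p) = coord d p.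
Proof. by move=> cp; rewrite /transition /= coordK. Qed.

Section TwoCharts.
Variables (c d : chart M).
Local Notation W := (coord c @` (dom c `&` dom d)).
Local Notation t := (transition c d).
Local Notation J := (transition_jac c d).

Lemma overlap_open : open W.
Proof. by apply: chart_image_open; exact: dom_open. Qed.
Let oW := overlap_open.

Lemma transition_smooth_on : smooth W t.
Proof. exact: transition_smooth. Qed.
Let st := transition_smooth_on.

Lemma overlap_chart x : W x -> (coord c @` dom c) x.
Proof. by move=> [p [cp dp] <-]; exists p. Qed.

Lemma overlap_transition x : W x -> (coord d @` dom d) (t x).
Proof. by move=> [p [cp dp] <-]; exists p => //; rewrite transition_coord. Qed.

Lemma transition_jacE i k x : W x -> J x i k = dmx i t x 0 k.
Proof. by move=> Wx; rewrite mxE partial_mx//; exact: (smooth_diff st). Qed.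

Lemma transition_jac_msmooth : msmooth W J.
Proof.
move=> i k; apply: smooth_ext (msmooth_dmx i oW ((smooth_mxP _ oW).1 st) 0 k) => //.
by move=> x Wx; rewrite transition_jacE.
Qed.
Let sJ := transition_jac_msmooth.

Lemma dtransition_jac_sym i j k x : W x -> dmx i J x j k = dmx j J x i k.
Proof.
move=> Wx; have stm := (smooth_mxP _ oW).1 st.
have E a b : dmx a J x b k = dmx a (dmx b t) x 0 k.
  rewrite !dmxE; apply: partial_near_eq; apply: near_open oW _ _ Wx => y.
  exact: transition_jacE.
by rewrite !E (dmxC Wx i j oW stm).
Qed.

Lemma dmx_transition q r l (F : vec -> 'M[R]_(q, r)) x : W x ->
  msmooth (coord d @` dom d) F ->
  dmx l (fun y => F (t y)) x = \sum_a J x l a *: dmx a F (t x).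
Proof.
move=> Wx sF; rewrite (dmx_comp st l Wx (overlap_transition Wx) sF).
by apply: eq_bigr => a _; rewrite mxE.
Qed.

Variable g : metric M.

Lemma metric_transition x : W x -> g c x = J x *m g d (t x) *m (J x)^T.
Proof. by move=> [p [cp dp] <-]; rewrite transition_coord//; exact: gij_law. Qed.

Lemma transition_jac_unit x : W x -> J x \in unitmx.
Proof.
move=> Wx; have := metric_unit g (overlap_chart Wx).
by rewrite metric_transition// -mulmxA unitmx_mul => /andP[].
Qed.

Let B i x : 'M[R]_n := \sum_a J x i a *: conn g d a (t x).

Let sconn a : msmooth W (fun x => conn g d a (t x)).
Proof.
apply: (msmooth_comp oW st _ (conn_msmooth g d a)).
exact: overlap_transition.
Qed.

Let sB i : msmooth W (B i).
Proof.
apply: msmooth_sum => // a.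
exact: (msmoothZ oW (sJ i a) (sconn a)).
Qed.

(** The connection of [d], written in the coordinates of [c], is symmetric because the second
    derivatives of the transition map are, and compatible with the metric by the law of the latter.
    Uniqueness does the rest. *)
Lemma conn_transition i x : W x ->
  conn g c i x *m J x = J x *m B i x + dmx i J x.
Proof.
move=> Wx; have uJ := transition_jac_unit Wx.
have Ucx := overlap_chart Wx; have Udx := overlap_transition Wx.
pose A' k := (J x *m B k x + dmx k J x) *m invmx (J x).
suff -> : conn g c i x = A' i by rewrite /A' mulmxKV.
apply: (@metric_connection_unique _ _ (g c x) (fun k => conn g c k x) A'
  (metric_unit g Ucx) (metric_sym g Ucx)) => [a b k|a b k|a].
- exact: conn_sym.
- rewrite /A' !(mulmx_entry _ (invmx _)); apply: eq_bigr => m _; congr (_ * _).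
  rewrite !mx_linE (dtransition_jac_sym a b)//; congr (_ + _).
  rewrite /B !mulmx_sumr !summxE.
  under eq_bigr do rewrite -scalemxAr !mx_linE mulmx_entry big_distrr.
  under [RHS]eq_bigr do rewrite -scalemxAr !mx_linE mulmx_entry big_distrr.
  rewrite exchange_big /=; apply: eq_bigr => u _; apply: eq_bigr => v _.
  by rewrite (conn_sym g u v m Udx); move: (J x a v) (J x b u) (conn _ _ _ _ _ _) => p q r; ring.
have sH : msmooth W (fun y => g d (t y)).
  by apply: (msmooth_comp oW st _ (metric_msmooth g d)); exact: overlap_transition.
have sJT := msmoothT sJ.
have dG : dmx a (g c) x = dmx a J x *m g d (t x) *m (J x)^T
   + J x *m (B a x *m g d (t x) + g d (t x) *m (B a x)^T) *m (J x)^T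
   + J x *m g d (t x) *m (dmx a J x)^T.
  rewrite (dmx_ext a oW metric_transition Wx) (dmxM Wx a (msmoothM oW sJ sH) sJT).
  rewrite (dmxM Wx a sJ sH) dmxT (dmx_transition a Wx (metric_msmooth g d)).
  rewrite [X in J x *m X](_ : _ = B a x *m g d (t x) + g d (t x) *m (B a x)^T).
    by rewrite mulmxDl.
  rewrite /B mulmx_suml linear_sum mulmx_sumr -big_split /=; apply: eq_bigr => k _.
  by rewrite conn_metric// linearZ /= -scalemxAl -scalemxAr scalerDr.
have A'G : A' a *m g c x = (J x *m B a x + dmx a J x) *m g d (t x) *m (J x)^T.
  by rewrite metric_transition// /A' !mulmxA mulmxKV.
rewrite A'G; have -> : conn g c a x *m g c x + (conn g c a x *m g c x)^T = dmx a (g c) x.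
  by rewrite conn_metric// trmx_mul metric_sym.
rewrite dG (trmx_mul _ (J x)^T) trmxK (trmx_mul _ (g d (t x))) (metric_sym g Udx).
rewrite trmx_addE trmx_mul.
by mx_noncomm.
Qed.

Lemma curv_transition i j x : W x -> curv g c i j x *m J x =
  J x *m \sum_a \sum_b (J x i a * J x j b) *: curv g d a b (t x).
Proof.
move=> Wx; have Ucx := overlap_chart Wx; have Udx := overlap_transition Wx.
have sAc k : msmooth W (conn g c k).
  by apply: msmooth_sub (conn_msmooth g c k) => y; exact: overlap_chart.
(* [P] collects the derivatives of the Jacobian; it is symmetric in [k] and [l], so it drops out of
   the curvature, and [Q] gives the derivatives of the connection of [d]. *)
pose P k l := \sum_a dmx k J x l a *: conn g d a (t x).
pose Q k l := \sum_b \sum_a (J x k a * J x l b) *: dmx a (conn g d b) (t x).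
have dB k l : dmx k (B l) x = P k l + Q k l.
  rewrite (dmx_sum Wx k (fun a => msmoothZ oW (sJ l a) (sconn a))) -big_split /=.
  apply: eq_bigr => b _; rewrite (dmxZ Wx k (sJ l b) (sconn b)) -dmxE; congr (_ + _).
  rewrite (dmx_transition k Wx (conn_msmooth g d b)) scaler_sumr.
  by apply: eq_bigr => a _; rewrite scalerA mulrC.
have PC : P i j = P j i.
  by apply: eq_bigr => a _; rewrite dtransition_jac_sym.
have dA k l : dmx k (conn g c l) x *m J x = dmx k J x *m B l x + J x *m (P k l + Q k l)
    + dmx k (dmx l J) x - conn g c l x *m dmx k J x.
  rewrite -dB; apply/eqP; rewrite eq_sym subr_eq eq_sym; apply/eqP.
  have sdJ := msmooth_dmx l oW sJ.
  rewrite -(dmxM Wx k (sAc l) sJ) -(dmxM Wx k sJ (sB l)) -(dmxD Wx k (msmoothM oW sJ (sB l)) sdJ).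
  by apply: (dmx_ext k oW _ Wx) => y; exact: conn_transition.
have dJ k : dmx k J x = conn g c k x *m J x - J x *m B k x.
  by rewrite conn_transition// addrC addKr.
have -> : \sum_a \sum_b (J x i a * J x j b) *: curv g d a b (t x) =
    Q i j - Q j i + B j x *m B i x - B i x *m B j x.
  have Qij : Q i j = \sum_a \sum_b (J x i a * J x j b) *: dmx a (conn g d b) (t x).
    by rewrite /Q exchange_big.
  have Qji : Q j i = \sum_a \sum_b (J x i a * J x j b) *: dmx b (conn g d a) (t x).
    by apply: eq_bigr => a _; apply: eq_bigr => b _; rewrite mulrC.
  have Bji : B j x *m B i x = \sum_a \sum_b (J x i a * J x j b) *:
      (conn g d b (t x) *m conn g d a (t x)).
    rewrite /B mulmx_suml [RHS]exchange_big /=; apply: eq_bigr => b _.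
    rewrite mulmx_sumr; apply: eq_bigr => a _.
    by rewrite -scalemxAl -scalemxAr scalerA mulrC.
  have Bij : B i x *m B j x = \sum_a \sum_b (J x i a * J x j b) *:
      (conn g d a (t x) *m conn g d b (t x)).
    rewrite /B mulmx_suml; apply: eq_bigr => a _.
    rewrite mulmx_sumr; apply: eq_bigr => b _.
    by rewrite -scalemxAl -scalemxAr scalerA.
  rewrite Qij Qji Bji Bij -sumrB -big_split -sumrB /=; apply: eq_bigr => a _.
  rewrite -sumrB -big_split -sumrB /=; apply: eq_bigr => b _.
  by rewrite /curv !scalerDr !scalerN.
rewrite /curv !mulmxDl !mulNmx !dA PC (dmxC Wx i j oW sJ) !dJ.
by mx_noncomm.
Qed.

Lemma ricci_transition x : W x -> ricci g c x = J x *m ricci g d (t x) *m (J x)^T.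
Proof.
move=> Wx; rewrite !ricciE; apply: ricci_of_transform (transition_jac_unit Wx) _.
by move=> i j; exact: curv_transition.
Qed.

Lemma ricci_op_transition x : W x ->
  ricci_op g c x = J x *m ricci_op g d (t x) *m invmx (J x).
Proof.
move=> Wx; have uJ := transition_jac_unit Wx.
have uGc := metric_unit g (overlap_chart Wx).
have uGd := metric_unit g (overlap_transition Wx).
rewrite /ricci_op; apply: (canLR (mulmxK uGc)).
rewrite ricci_transition// [in RHS]metric_transition//.
by rewrite !mulmxA mulmxKV// mulmxKV.
Qed.

End TwoCharts.

(** * Scalar invariants of the Ricci operator *)

Section InvariantScalars.
Variables (g : metric M) (c d : chart M) (p : M).
Hypotheses (cp : dom c p) (dp : dom d p).

Let Wp : (coord c @` (dom c `&` dom d)) (coord c p). Proof. by exists p. Qed.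

Let opE : exists2 J : 'M[R]_n, J \in unitmx &
  ricci_op g c (coord c p) = J *m ricci_op g d (coord d p) *m invmx J.
Proof.
exists (transition_jac c d (coord c p)); first exact: transition_jac_unit g _ Wp.
by rewrite (ricci_op_transition g Wp) transition_coord.
Qed.

Let conjM (J A B : 'M[R]_n) : J \in unitmx ->
  (J *m A *m invmx J) *m (J *m B *m invmx J) = J *m (A *m B) *m invmx J.
Proof. by move=> uJ; rewrite !mulmxA mulmxKV. Qed.

Let conj_tr (J A : 'M[R]_n) : J \in unitmx -> \tr (J *m A *m invmx J) = \tr A.
Proof. by move=> uJ; rewrite mxtrace_mulC mulKmx. Qed.

Lemma scal_transition : scal g c (coord c p) = scal g d (coord d p).
Proof. by have [J uJ E] := opE; rewrite /scal E conj_tr. Qed.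

Lemma ricci_sqr_transition : ricci_sqr g c (coord c p) = ricci_sqr g d (coord d p).
Proof. by have [J uJ E] := opE; rewrite /ricci_sqr E conjM// conj_tr. Qed.

Lemma defect_transition : defect g c (coord c p) = defect g d (coord d p).
Proof.
have [J uJ E] := opE; rewrite /defect.
have -> : defect_op g c (coord c p) = J *m defect_op g d (coord d p) *m invmx J.
  by rewrite /defect_op scal_transition E conjM// mulmxBr mulmxBl -scalemxAr -scalemxAl.
by rewrite conjM// conj_tr.
Qed.

End InvariantScalars.

Lemma transition_jac_comp c d e p : dom c p -> dom d p -> dom e p ->
  transition_jac c e (coord c p) =
  transition_jac c d (coord c p) *m transition_jac d e (coord d p).
Proof.
move=> cp dp ep; set x := coord c p.
pose V := coord c @` (dom c `&` (dom d `&` dom e)).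
have oV : open V by apply: chart_image_open; apply: openI; exact: dom_open.
have Vx : V x by exists p.
have VW y : V y -> (coord c @` (dom c `&` dom d)) y by move=> [q [? [? ?]] <-]; exists q.
have Wx := VW x Vx.
have Wdp : (coord d @` (dom d `&` dom e)) (coord d p) by exists p.
have Wcep : (coord c @` (dom c `&` dom e)) x by exists p.
apply/matrixP => i k; rewrite transition_jacE// mxE.
have std := (smooth_mxP _ (@overlap_open d e)).1 (@transition_smooth_on d e).
rewrite (dmx_ext (G := fun y => transition d e (transition c d y)) i oV _ Vx); last first.
  by move=> y [q [cq [dq eq]] <-]; rewrite !transition_coord.
have stx : (coord d @` (dom d `&` dom e)) (transition c d x) by rewrite transition_coord.
rewrite (dmx_comp (@transition_smooth_on c d) i Wx stx std) summxE.
apply: eq_bigr => a _; rewrite mx_linE transition_coord// -transition_jacE//.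
by congr (_ * _); rewrite [RHS]mxE.
Qed.

End ChartChange.

(** * Global objects *)

Section TensorRow.
Variables (R : realType) (n : nat) (M : manifold R n).
Local Notation vec := 'rV[R]_n.

(* The form is the contraction of [T] with a coordinate vector field of [c]; the
   latter is written in the chart [d] with the inverse of the Jacobian from [d]
   to [c], which is a function of the coordinates of [d]. *)
Lemma tensor_row_form (g : metric M) (T : chart M -> vec -> 'M[R]_n) (O : set M)
    (p : M) (c : chart M) :
  open O -> O p -> dom c p ->
  (forall d, msmooth (coord d @` dom d) (T d)) ->
  (forall (d e : chart M) (q : M), dom d q -> dom e q -> T d (coord d q) =
    transition_jac d e (coord d q) *m T e (coord e q) *m (transition_jac d e (coord d q))^T) ->
  T c (coord c p) != 0 ->
  exists (U : set M) (w : oneForm U), [/\ open U, U p, U `<=` O &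
    forall (d : chart M) (q : M), U q -> dom d q -> w d (coord d q) != 0 /\
      exists v, w d (coord d q) = v *m T d (coord d q)].
Proof.
move=> oO Op cp sT lawT T0.
have uJ (d e : chart M) (q : M) : dom d q -> dom e q ->
    transition_jac d e (coord d q) \in unitmx.
  by move=> dq eq; apply: (transition_jac_unit g); exists q.
pose v0 i (d : chart M) x : vec := delta_mx 0 i *m invmx (transition_jac d c x).
pose w0 i (d : chart M) x : vec := v0 i d x *m T d x.
have [i w0p] : exists i, w0 i c (coord c p) != 0.
  have : invmx (transition_jac c c (coord c p)) *m T c (coord c p) != 0.
    apply: contra T0 => /eqP E; have u := uJ c c p cp cp.
    by rewrite -[T c _](mulKVmx u) E mulmx0.
  move=> nz; apply/existsP; apply: contraR nz => /existsPn E.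
  apply/eqP/row_matrixP => i; rewrite row0 rowE mulmxA.
  by move: (E i); rewrite negbK => /eqP.
have w0_law (d e : chart M) (q : M) : dom c q -> dom d q -> dom e q ->
    w0 i d (coord d q) = w0 i e (coord e q) *m (transition_jac d e (coord d q))^T.
  move=> cq dq eq; rewrite /w0 /v0 (lawT d e q dq eq).
  have <- : invmx (transition_jac d c (coord d q)) *m transition_jac d e (coord d q)
      = invmx (transition_jac e c (coord e q)).
    rewrite -[RHS]mul1mx; apply: (canRL (mulmxK (uJ _ _ _ eq cq))).
    by rewrite -mulmxA -(transition_jac_comp dq eq cq) mulVmx// uJ.
  by rewrite !mulmxA.
pose U := [set q | [/\ dom c q, O q & w0 i c (coord c q) != 0]].
have sw (d : chart M) : msmooth (coord d @` (dom d `&` dom c)) (w0 i d).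
  have oW := @overlap_open _ _ M d c.
  apply: (msmoothM oW); last first.
    by apply: msmooth_sub (sT d) => x [q [dq _] <-]; exists q.
  apply: (msmoothM oW (msmooth_cst _ oW)); apply: (msmoothV oW).
    by move=> x [q [dq cq] <-]; exact: uJ.
  exact: transition_jac_msmooth.
have oU : open U.
  rewrite openE => q [cq Oq wq].
  have [j wj] : exists j, w0 i c (coord c q) 0 j != 0.
    apply/existsP; apply: contraR wq => /existsPn E; apply/eqP/rowP => j.
    by rewrite [RHS]mxE; move: (E j); rewrite negbK => /eqP.
  have Wq : (coord c @` (dom c `&` dom c)) (coord c q) by exists q.
  have cw := smooth_continuous (sw c 0 j) Wq.
  have nw : nbhs (coord c q) [set x | w0 i c x 0 j != 0].
    exact: (cw _ (open_nbhs_nbhs (conj (@open_neq R 0) wj))).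
  have nd := open_nbhs_nbhs (conj (@dom_open _ _ M c) cq).
  have nO := open_nbhs_nbhs (conj oO Oq).
  apply: (filterS3 _ _ nd nO (coord_cont cq nw)) => r cr Or /= wr.
  by split=> //; apply: contra wr => /eqP ->; rewrite mxE.
have fsm (d : chart M) : smooth (coord d @` (dom d `&` U)) (w0 i d).
  have oWU : open (coord d @` (dom d `&` U)) by exact: chart_image_open.
  apply/(smooth_mxP _ oWU); apply: msmooth_sub (sw d) => x [q [dq [cq _ _]] <-].
  by exists q.
have flaw (d e : chart M) (q : M) : U q -> dom d q -> dom e q ->
    w0 i d (coord d q) = w0 i e (coord e q) *m (transition_jac d e (coord d q))^T.
  by move=> [cq _ _]; exact: w0_law.
exists U, (OneForm fsm flaw); split => //; first by move=> q [].
move=> d q [cq Oq wq] dq /=; split; last by exists (v0 i d (coord d q)).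
by apply: contra wq => /eqP E; rewrite (w0_law c d q cq cq dq) E mul0mx.
Qed.

End TensorRow.

(** * Functions on the manifold given by invariant scalars, and their zero sets *)

Section GluedScalars.
Variables (R : realType) (n : nat) (M : manifold R n).
Local Notation vec := 'rV[R]_n.

Definition chart_at (p : M) : chart M := sval (cid (dom_cover p)).

Lemma chart_atP p : dom (chart_at p) p.
Proof. exact: (svalP (cid (dom_cover p))). Qed.

Definition glue (f : chart M -> vec -> R) (p : M) : R :=
  f (chart_at p) (coord (chart_at p) p).

Lemma near_chart (c : chart M) (p : M) (P : set vec) : dom c p ->
  nbhs (coord c p) P -> \forall q \near p, dom c q /\ P (coord c q).
Proof.
move=> cp nP; have nd := open_nbhs_nbhs (conj (@dom_open _ _ M c) cp).
by apply: (filterS2 _ _ nd (coord_cont cp nP)).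
Qed.

Section Glue.
Variable f : chart M -> vec -> R.
Hypothesis finv : forall (c d : chart M) (p : M),
  dom c p -> dom d p -> f c (coord c p) = f d (coord d p).
Hypothesis fsm : forall c : chart M, smooth (coord c @` dom c) (f c : vec -> R^o).

Lemma glueE c p : dom c p -> glue f p = f c (coord c p).
Proof. by move=> cp; apply: finv => //; exact: chart_atP. Qed.

Lemma glue_smooth : smooth_fun (glue f).
Proof.
move=> c; apply: smooth_ext (fsm c); first exact: coord_open.
by move=> x [p cp <-] /=; rewrite coordK// (glueE cp).
Qed.

Lemma glue_neq0_open : open [set p | glue f p != 0].
Proof.
rewrite openE => p /= fp; have cp := chart_atP p; set c := chart_at p in cp.
have Up : (coord c @` dom c) (coord c p) by exists p.
have cf := smooth_continuous (fsm c) Up.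
rewrite (glueE cp) in fp.
have nf : nbhs (coord c p) [set x | f c x != 0].
  exact: (cf _ (open_nbhs_nbhs (conj (@open_neq R 0) fp))).
by apply: filterS (near_chart cp nf) => q [cq]; rewrite /= (glueE cq).
Qed.

Variables (k : R) (be : oneForm [set: M]).
Hypothesis df : forall (c : chart M) l x, (coord c @` dom c) x ->
  partial l (f c : vec -> R^o) x = (k * be c x 0 l) * f c x.

Lemma form_entry_smooth c l :
  smooth (coord c @` dom c) (fun x => be c x 0 l : R^o).
Proof.
apply: ((smooth_mxP _ (@coord_open _ _ M c)).1 _ 0 l).
by apply: smooth_sub (form_smooth be c) => x [p cp <-]; exists p.
Qed.

Lemma glue_eq0_open : open [set p | glue f p = 0].
Proof.
rewrite openE => p /= fp; have cp := chart_atP p; set c := chart_at p in cp.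
have Up : (coord c @` dom c) (coord c p) by exists p.
rewrite (glueE cp) in fp.
have nf : nbhs (coord c p) [set x | f c x = 0].
  apply: (zero_near (@coord_open _ _ M c) _ _ _ Up fp (phi := fun l x => k * be c x 0 l)).
  - by move=> x; exact: smooth_diff (fsm c).
  - move=> l x Ux.
    exact: (smooth_continuous (smoothM (@coord_open _ _ M c)
      (smooth_cst (k : R^o) (@coord_open _ _ M c)) (form_entry_smooth c l)) Ux).
  - by move=> l x; exact: df.
by apply: filterS (near_chart cp nf) => q [cq] /=; rewrite (glueE cq).
Qed.

(** The zero set is open by the differential equation and closed by continuity. *)
Lemma glue_eq0_component p q : connected_component [set: M] p q ->
  glue f p = 0 -> glue f q = 0.
Proof.
move=> pq fp; set C := connected_component [set: M] p.
suff E : C `&` [set r | glue f r = 0] = C by move: pq; rewrite -/C -E => -[].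
apply: (@component_connected _ [set: M] p).
- by exists p; split => //; exact: connected_component_refl.
- by exists [set r | glue f r = 0] => //; exact: glue_eq0_open.
- exists [set r | glue f r = 0] => //.
  rewrite -[X in closed X]setCK; apply: open_closedC.
  rewrite (_ : ~` _ = [set r | glue f r != 0]); first exact: glue_neq0_open.
  by apply/seteqP; split => r /= /eqP.
Qed.

End Glue.
End GluedScalars.

(** * Ricci recurrent manifolds *)

Section RicciRecurrent.
Variables (R : realType) (n : nat) (M : manifold R n) (g : metric M).
Variable beta : oneForm [set: M].
Hypothesis beta_nz : form_nonzero beta.
Hypothesis rec : forall (c : chart M) (p : M), dom c p -> forall i j l,
  cov_deriv g (ricci g) c (coord c p) i j l =
  beta c (coord c p) 0 l * ricci g c (coord c p) i j.

Local Notation U c := (coord c @` dom c).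

Let recE (c : chart M) l x : U c x -> dmx l (ricci g c) x =
  beta c x 0 l *: ricci g c x + conn g c l x *m ricci g c x
  + ricci g c x *m (conn g c l x)^T.
Proof.
move=> [p cp <-]; apply/matrixP => i j.
have := rec cp i j l; rewrite cov_derivE !mx_linE => <-.
by ring.
Qed.

Let sqr_inv (c d : chart M) (p : M) : dom c p -> dom d p ->
  ricci_sqr g c (coord c p) = ricci_sqr g d (coord d p).
Proof. exact: ricci_sqr_transition. Qed.

Let scal_inv (c d : chart M) (p : M) : dom c p -> dom d p ->
  scal g c (coord c p) = scal g d (coord d p).
Proof. exact: scal_transition. Qed.

Let defect_inv (c d : chart M) (p : M) : dom c p -> dom d p ->
  defect g c (coord c p) = defect g d (coord d p).
Proof. exact: defect_transition. Qed.

Let sbeta := form_entry_smooth beta.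

Let sqr_smooth c : smooth (U c) (ricci_sqr g c : _ -> R^o).
Proof. exact: ricci_sqr_smooth. Qed.

Let sc_smooth c : smooth (U c) (scal g c : _ -> R^o).
Proof. exact: scal_smooth. Qed.

Let def_smooth c : smooth (U c) (defect g c : _ -> R^o).
Proof. exact: defect_smooth. Qed.

Let dsqr (c : chart M) l x : U c x ->
  partial l (ricci_sqr g c : _ -> R^o) x = (2 * beta c x 0 l) * ricci_sqr g c x.
Proof. exact: (partial_ricci_sqr (@recE c)). Qed.

Let dscal (c : chart M) l x : U c x ->
  partial l (scal g c : _ -> R^o) x = (1 * beta c x 0 l) * scal g c x.
Proof. by move=> Ux; rewrite mul1r; exact: (partial_scal (@recE c)). Qed.

Let ddef (c : chart M) l x : U c x ->
  partial l (defect g c : _ -> R^o) x = (4 * beta c x 0 l) * defect g c x.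
Proof. exact: (partial_defect (@recE c)). Qed.

Let sqr := glue (ricci_sqr g).

(** At the point of the component of [p] where [beta] is nonzero, |Ri|^2 cannot vanish, as the zero
    would spread to [p]. *)
Lemma recurrence_point p : sqr p != 0 -> exists (q : M) (c : chart M),
  [/\ connected_component [set: M] p q, dom c q, beta c (coord c q) != 0 &
      ricci_sqr g c (coord c q) != 0].
Proof.
move=> sp; have [q [c [pq cq bq]]] := beta_nz p; exists q, c; split => //.
apply: contra sp => /eqP sq; apply/eqP.
apply: (glue_eq0_component sqr_inv sqr_smooth dsqr (connected_component_sym pq)).
by rewrite (glueE sqr_inv cq).
Qed.

Lemma recurrent_not_quasi_einstein p : (3 < n)%N -> sqr p != 0 -> ~ quasi_einstein g.
Proof.
move=> n3 /recurrence_point[q [c [_ cq bq sq]]] [a [b [_ _ /(_ q)]]].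
move=> [V [w [_ Vq /(_ c q Vq cq)[w0 RiE]]]].
set x := coord c q in bq sq w0 RiE; have Ux : U c x by exists q.
suff n3' : n = 3%N by rewrite n3' in n3.
have pG := metric_posdef g Ux.
have b0 : beta c x *m invmx (g c x) != 0.
  apply: contra bq => /eqP E.
  by rewrite -[beta c x](mulmxKV (metric_unit g Ux)) E mul0mx.
have Ri0 : ricci g c x != 0.
  apply: contra sq => /eqP E; rewrite /ricci_sqr /ricci_op E !mul0mx.
  by rewrite linear0.
rewrite ricciE in Ri0 RiE.
apply: (quasi_einstein_dim pG _ _ b0 _ (ltnW n3) Ri0 w0 RiE).
- by move=> i j; exact: curv_metric_skew.
- move=> i j; rewrite -ricciE.
  exact: (curv_ricci_op_comm (sbeta c) (@recE c)).
- by rewrite -ricciE; exact: (recurrence_eigenvector (@recE c)).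
Qed.

Lemma recurrent_dim3 p : n = 3%N -> sqr p != 0 ->
  glue (defect g) p = 0 /\ glue (scal g) p != 0.
Proof.
move=> n3 /recurrence_point[q [c [pq cq bq sq]]].
have Ux : U c (coord c q) by exists q.
set x := coord c q in bq sq Ux.
have qp := connected_component_sym pq.
have b0 : beta c x *m invmx (g c x) != 0.
  apply: contra bq => /eqP E.
  by rewrite -[beta c x](mulmxKV (metric_unit g Ux)) E mul0mx.
have rhoE : ricci_op g c x *m ricci_op g c x = (scal g c x / 2) *: ricci_op g c x.
  have := @ricci_dim3 _ _ (g c x) (fun i j => curv g c i j x) _ n3 (metric_posdef g Ux).
  rewrite /= -ricciE => /(_ (beta c x *m invmx (g c x))); apply => //.
  - by move=> i j; exact: curv_skew.
  - by move=> i j; exact: curv_metric_skew.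
  - exact: ricci_sym.
  - by move=> i j; exact: (curv_ricci_op_comm (sbeta c) (@recE c)).
  - exact: (recurrence_eigenvector (@recE c)).
split.
  apply: (glue_eq0_component defect_inv def_smooth ddef qp).
  by rewrite (glueE defect_inv cq) /defect /defect_op rhoE subrr mul0mx linear0.
(* If s vanished at [p], it would vanish at [q], where the identity would give rho^2 = 0 and so
   |Ri|^2 = 0. *)
apply: contra sq => /eqP /(glue_eq0_component scal_inv sc_smooth dscal pq).
rewrite (glueE scal_inv cq) -/x => s0.
by rewrite /ricci_sqr rhoE s0 mul0r scale0r linear0.
Qed.

(* At the points where [defect] vanishes, [T] has rank one: its eigenvalues are
   the scalar curvature and 0. *)
Let T (c : chart M) x : 'M[R]_n := scal g c x *: g c x - 2 *: ricci g c x.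

Let TE (c : chart M) x : U c x -> T c x = (scal g c x *: 1%:M - 2 *: ricci_op g c x) *m g c x.
Proof.
by move=> Ux; rewrite mulmxBl -!scalemxAl mul1mx ricci_op_metric.
Qed.

(** The dimension enters here: 3 s - 2 s = s is the trace of [s] times a projection of rank one. *)
Let T_trace (c : chart M) x : n = 3%N -> U c x -> \tr (T c x *m invmx (g c x)) = scal g c x.
Proof.
move=> n3 Ux; have n3R : n%:R = 3 :> R by rewrite n3.
rewrite TE// mulmxK ?metric_unit// mxtraceD -scaleN1r !mxtraceZ mxtrace1 n3R.
by rewrite -/(scal g c x); ring.
Qed.

Let T_rank_one (c : chart M) x (v : 'rV[R]_n) : n = 3%N -> U c x -> scal g c x != 0 ->
  defect g c x = 0 -> let w := v *m T c x in w != 0 ->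
  T c x = scal g c x *: (((w *m invmx (g c x) *m w^T) 0 0)^-1 *: (w^T *m w)).
Proof.
move=> n3 Ux s0 d0; apply: rank_one_form => //; [exact: metric_posdef| | |exact: T_trace].
  by rewrite /T !trmx_addE !linearZ /= metric_sym// ricci_sym.
have -> : T c x *m invmx (g c x) = scal g c x *: 1%:M - 2 *: ricci_op g c x.
  by rewrite TE// mulmxK// metric_unit.
rewrite TE// mulmxA [RHS]scalemxAl; congr (_ *m _).
(* Given rho^2 = (s/2) rho, (s - 2 rho)^2 = s^2 - 4 s rho + 2 s rho = s (s - 2 rho). *)
have := defect_eq0 Ux d0.
move: (scal g c x) (ricci_op g c x) => s r rr.
rewrite mulmxBl !mulmxBr -!scalemxAl -!scalemxAr !mul1mx !mulmx1 rr.
apply/matrixP => i j.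
by rewrite !mx_linE; field.
Qed.

Let half_inv (k : R) (c d : chart M) (p : M) : dom c p -> dom d p ->
  k * scal g c (coord c p) = k * scal g d (coord d p).
Proof. by move=> cp dp; rewrite (scal_transition g cp dp). Qed.

Let half_smooth (k : R) c : smooth (U c) (fun x => k * scal g c x : R^o).
Proof.
have oU := @coord_open _ _ M c.
exact: (smoothM oU (smooth_cst (k : R^o) oU) (sc_smooth c)).
Qed.

Lemma recurrent_quasi_einstein : n = 3%N -> quasi_einstein g.
Proof.
move=> n3.
(* Where s is nonzero and the defect vanishes, s g - 2 Ri = s w (x) w / |w|^2, so a = s/2 and b =
   -s/2; both are smooth on all of [M] and vanish where Ri does. *)
exists (glue (fun c x => 2^-1 * scal g c x)), (glue (fun c x => - 2^-1 * scal g c x)).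
have sm k := glue_smooth (half_inv k) (half_smooth k).
split; [exact: sm|exact: sm|].
move=> p; have cp := chart_atP p; set c := chart_at p in cp.
have Up : U c (coord c p) by exists p.
have [sp|sp] := eqVneq (sqr p) 0.
  have oO := glue_eq0_open sqr_inv sqr_smooth dsqr.
  (* Near [p] both Ri and s vanish, so any form without zeros serves; it is taken from the rows of
     the metric. *)
  have g0 : g c (coord c p) != 0.
    apply: contra_eq_neq (mulVmx (metric_unit g Up)) => ->; rewrite mulmx0.
    apply/eqP => /(congr1 mxtrace); rewrite mxtrace0 mxtrace1 => /esym/eqP.
    by rewrite pnatr_eq0 n3.
  have [V [w [oV Vp VO wP]]] := tensor_row_form g oO sp cp (metric_msmooth g) (gij_law g) g0.
  exists V, w; split => // d q Vq dq; have [w0 _] := wP d q Vq dq; split => //.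
  have Uq : U d (coord d q) by exists q.
  have Ri0 : ricci g d (coord d q) = 0.
    by apply: ricci_sqr_eq0 => //; rewrite -(glueE sqr_inv dq); exact: VO.
  have s0 : scal g d (coord d q) = 0 by rewrite /scal /ricci_op Ri0 mul0mx linear0.
  by rewrite !(glueE (half_inv _) dq) s0 !mulr0 !scale0r addr0.
have [dp s1p] := recurrent_dim3 n3 sp.
(* The zero set of the defect is open by its differential equation, so both conditions persist near
   [p]. *)
have oO := openI (glue_eq0_open defect_inv def_smooth ddef) (glue_neq0_open scal_inv sc_smooth).
have sT d : msmooth (U d) (T d).
  have oU := @coord_open _ _ M d.
  exact: (msmoothB oU (msmoothZ oU (sc_smooth d) (metric_msmooth g d))
    (msmoothZ oU (smooth_cst (2 : R^o) oU) (ricci_msmooth g d))).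
have lawT (d e : chart M) (q : M) : dom d q -> dom e q -> T d (coord d q) =
    transition_jac d e (coord d q) *m T e (coord e q) *m (transition_jac d e (coord d q))^T.
  move=> dq eq; rewrite /T (scal_transition g dq eq) (gij_law g dq eq).
  have Wq : (coord d @` (dom d `&` dom e)) (coord d q) by exists q.
  rewrite (ricci_transition g Wq) transition_coord//.
  by rewrite mulmxBr mulmxBl -!scalemxAr -!scalemxAl.
have T0 : T c (coord c p) != 0.
  apply: contra s1p => /eqP E; rewrite (glueE scal_inv cp).
  by rewrite -(T_trace n3 Up) E mul0mx linear0.
have [V [w [oV Vp VO wP]]] := tensor_row_form g oO (conj dp s1p) cp sT lawT T0.
exists V, w; split => // d q Vq dq; have [w0 [v wE]] := wP d q Vq dq; split => //.
have Uq : U d (coord d q) by exists q.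
have [] := VO q Vq; rewrite /= (glueE defect_inv dq) (glueE scal_inv dq) => dq0 sq0.
rewrite !(glueE (half_inv _) dq) /norm2 /inv_metric.
move: w0; rewrite {}wE => w0; have := T_rank_one n3 Uq sq0 dq0 w0.
rewrite /= {1}/T; move: (_^-1 *: _) => Z E.
rewrite mulNr scaleNr -[X in _ = _ - X]scalerA -E scalerBr !scalerA opprB.
by rewrite mulVf ?pnatr_eq0// scale1r addrC subrK.
Qed.

End RicciRecurrent.

Theorem theorem3p4 (R : realType) (n : nat) (M : manifold R n) (g : metric M)
    (n_ge3 : (3 <= n)%N) (Ri_neq0 : ricci_nonzero g) :
  (n = 3%N -> ricci_recurrent g -> quasi_einstein g) /\
  ((3 < n)%N -> ~ (ricci_recurrent g /\ quasi_einstein g)).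
Proof.
split=> [n3 [beta bnz rec]|n3 [[beta bnz rec]]].
  exact: (recurrent_quasi_einstein bnz rec n3).
have [c [p [cp Ri0]]] := Ri_neq0.
apply: (recurrent_not_quasi_einstein bnz rec (p := p) n3).
rewrite (glueE (@ricci_sqr_transition _ _ _ g) cp); apply: contra Ri0 => /eqP s0.
by apply/eqP/ricci_sqr_eq0 => //; exists p.
Qed.
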